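(* Let $H$ be a hedge graph whose hedge intersection graph is acyclic. Then there is a polynomial-time algorithm for \textsc{Hedge Cluster Deletion} on $H$ (computing a minimum set of hedges whose removal leaves a cluster graph).
   Context: A hedge graph $H$ is a simple graph whose edge set is partitioned into classes called hedges $E_1,\dots,E_\ell$. \textsc{Hedge Cluster Deletion} asks for a minimum (or at most $k$) set $U$ of hedges such that after deleting all edges of hedges in $U$ every connected component is a clique (a cluster graph). The hedge intersection graph of $H$ is the simple graph whose vertices are the hedges of $H$, where two distinct hedges $E_i,E_j$ are adjacent iff there are edges $e_i\in E_i$ and $e_j\in E_j$ of $H$ sharing a common endpoint. Acyclic means having no cycle (a forest). *)

(* Defs.v *)
From mathcomp Require Import all_boot.

Set Implicit Arguments.
Unset Strict Implicit.
Unset Printing Implicit Defensive.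

(** * Deterministic multi-tape Turing machines *)

Inductive move := MoveL | Stay | MoveR.

(* [None] is the blank, [Some (inl b)] an input/output bit, and
   [Some (inr g)] an auxiliary work symbol. *)
Definition symbol (G : finType) : finType := option (bool + G)%type.

(* A two-way infinite tape around its head: [lhs] lists the cells to the left
   (nearest first), [rhs] those to the right; cells not listed are blank. *)
Record tape (G : finType) :=
  Tape { lhs : seq (symbol G); scanned : symbol G; rhs : seq (symbol G) }.

Definition tape_of (G : finType) (w : seq (symbol G)) : tape G :=
  if w is a :: w' then Tape [::] a w' else Tape [::] None [::].

Definition tape_write (G : finType) (a : symbol G) (t : tape G) : tape G :=
  Tape (lhs t) a (rhs t).

Definition tape_move (G : finType) (d : move) (t : tape G) : tape G :=
  match d with
  | MoveL => if lhs t is a :: l then Tape l a (scanned t :: rhs t)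
             else Tape [::] None (scanned t :: rhs t)
  | Stay => t
  | MoveR => if rhs t is a :: r then Tape (scanned t :: lhs t) a r
             else Tape (scanned t :: lhs t) None [::]
  end.

(* The machine has [ntapes.+1] tapes. *)
Record machine := Machine {
  ntapes : nat;
  work : finType;
  state : finType;
  start : state;
  halting : pred state;
  delta : state -> {ffun 'I_ntapes.+1 -> symbol work} ->
          state * {ffun 'I_ntapes.+1 -> symbol work * move}
}.

Record config (M : machine) :=
  Config { cstate : state M; ctapes : {ffun 'I_(ntapes M).+1 -> tape (work M)} }.

Definition halted (M : machine) (c : config M) : bool := halting (cstate c).

Definition step (M : machine) (c : config M) : config M :=
  if halted c then c else
  let: (q, act) := delta (cstate c) [ffun i => scanned (ctapes c i)] in
  Config q [ffun i => tape_move (act i).2 (tape_write (act i).1 (ctapes c i))].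

(* The input is on the first tape, with the head on its first bit. *)
Definition initial (M : machine) (w : seq bool) : config M :=
  Config (start M)
    [ffun i => tape_of (if i == ord0 then [seq Some (inl b) | b <- w]
                        else [::])].

Fixpoint leading_bits (G : finType) (s : seq (symbol G)) : seq bool :=
  if s is Some (inl b) :: s' then b :: leading_bits s' else [::].

(* The output is on the last tape, starting at the head and extending to the
   first cell that does not hold a bit. *)
Definition output (M : machine) (c : config M) : seq bool :=
  let t := ctapes c ord_max in leading_bits (scanned t :: rhs t).

Definition computes_within (M : machine) (w : seq bool) (T : nat)
    (v : seq bool) : Prop :=
  exists t, [/\ t <= T, halted (iter t (@step M) (initial M w)) &
                output (iter t (@step M) (initial M w)) = v].

(** * Polynomial-time solvability of a search problem on a class of instances *)

(* One machine must serve every instance [x] satisfying [P]; it may output any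
   of the solutions of [x], and is unconstrained on other inputs. *)
Definition poly_time_solvable (I : Type) (O : I -> Type)
    (encI : I -> seq bool) (encO : forall x, O x -> seq bool)
    (P : I -> Prop) (solution : forall x, O x -> Prop) : Prop :=
  exists (M : machine) (c d : nat), forall x : I, P x ->
    exists2 y : O x, solution x y &
      computes_within M (encI x) (c * size (encI x) ^ d + c) (encO x y).

(** * Hedge graphs *)

Record hedge_graph := HedgeGraph {
  nv : nat;
  nh : nat;
  edges : {set {set 'I_nv}};
  hedge : 'I_nh -> {set {set 'I_nv}};
  edges_card2 : forall e, e \in edges -> #|e| = 2;
  hedge_inj : injective hedge;
  hedge_partition : partition [set hedge k | k : 'I_nh] edges
}.

Definition hedge_intersection (H : hedge_graph) : rel 'I_(nh H) :=
  fun i j => (i != j) &&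
    [exists e in hedge i, [exists f in hedge j, e :&: f != set0]].

Definition acyclic (T : finType) (e : rel T) : Prop :=
  ~ exists c : seq T, 2 < size c /\ ucycle e c.

Definition remaining_edges (H : hedge_graph) (U : {set 'I_(nh H)}) :
    {set {set 'I_(nv H)}} :=
  edges H :\: \bigcup_(k in U) hedge k.

Definition remaining_adj (H : hedge_graph) (U : {set 'I_(nh H)}) :
    rel 'I_(nv H) :=
  fun x y => [set x; y] \in remaining_edges U.

Definition is_cluster (T : finType) (e : rel T) : Prop :=
  forall x y, connect e x y -> x != y -> e x y.

Definition cluster_deletion (H : hedge_graph) (U : {set 'I_(nh H)}) : Prop :=
  is_cluster (remaining_adj U).

Definition min_cluster_deletion (H : hedge_graph) (U : {set 'I_(nh H)}) : Prop :=
  cluster_deletion U /\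
  forall U' : {set 'I_(nh H)}, cluster_deletion U' -> #|U| <= #|U'|.

(** * Encodings *)

Definition adj_matrix (H : hedge_graph) (k : 'I_(nh H)) : seq bool :=
  [seq [set i; j] \in hedge k | i <- enum 'I_(nv H), j <- enum 'I_(nv H)].

(* The numbers of vertices and hedges in unary, then one adjacency matrix per
   hedge. Hedges being nonempty, [nh H] is at most the number of edges, so the
   length of the code is polynomially related to the size of the graph. *)
Definition encode_graph (H : hedge_graph) : seq bool :=
  nseq (nv H) true ++ false :: nseq (nh H) true ++ false ::
  flatten [seq adj_matrix k | k <- enum 'I_(nh H)].

Definition encode_hedges (H : hedge_graph) (U : {set 'I_(nh H)}) : seq bool :=
  [seq k \in U | k <- enum 'I_(nh H)].

(* Main.v *)
Require Import Defs.
From mathcomp Require Import all_boot.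
From mathcomp Require Import zify.
From Stdlib Require Import FunctionalExtensionality.

(* Since a forest has no triangle, any third edge closing a path made of two
   edges from distinct hedges lies in one of these two hedges or does not exist.
   Hence a set of kept hedges leaves a cluster graph iff it satisfies constraints
   of two kinds, each on at most two hedges: "not both [i] and [j]" and "[i]
   requires [j]". Two hedges tied by a constraint are adjacent in the
   intersection graph, so the constraints form a forest, and a maximum set of
   kept hedges is found by repeatedly merging a leaf into its only neighbour,
   storing with each hedge the best kept sets of its merged subtree in the two
   cases where the hedge itself is kept or not.

   On the machine side, one round of merging is definable by an expression with
   bounded counting quantifiers over indices below the length [L] of the input.
   Any such update of a bit array of length [L] can be iterated [L] times by a
   multi-tape machine that keeps each variable as a head position; every loop
   then runs at most [L + 1] rounds, so that the running time is bounded by a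
   power of [L] that depends only on the program text. *)

Set Implicit Arguments.
Unset Strict Implicit.
Unset Printing Implicit Defensive.

(** * Tapes as functions *)

(** Since one round updates a single array of [L] bits, the whole state of the merging process must
    fit there. It consists of two sets of hedges per hedge, hence [2 h^2] bits for [h] hedges on [n]
    vertices. Hedges are nonempty and disjoint, so [h] is at most [n] choose 2 and [2 h^2 <= h n^2],
    which is the room taken by the adjacency matrices in the input. No bits are left over for flags:
    whether a hedge is unmerged, or can be kept, is coded by its membership in its own two sets.
    Each new bit is computed from the old array independently of the other new bits, so all of them
    must agree on the leaf being merged; the leaf of least index is taken. Once no leaf is left a
    round changes nothing, and [L] exceeds the number of hedges, so a fixed number of [L] rounds
    needs no stopping test. A forest without a leaf has no edge, so the surviving hedges are then
    decided independently. Arithmetic saturates at [L] because registers cannot go further; the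
    addresses that matter stay below [L], so saturation never falsifies them. *)

Definition sym := symbol bool.
Definition left_end : sym := Some (inr false).
Definition right_end : sym := Some (inr true).

Definition atape := ((nat -> sym) * nat)%type.
Definition store := nat -> atape.

Definition ascan (t : atape) : sym := t.1 t.2.

Definition awrite (w : option sym) (t : atape) : atape :=
  if w is Some a then (fun i => if i == t.2 then a else t.1 i, t.2) else t.

(** A left move from position 0 shifts the contents instead, so that positions remain natural
    numbers on a tape infinite to the left. *)
Definition amove (d : move) (t : atape) : atape :=
  match d with
  | MoveL => if t.2 is p.+1 then (t.1, p)
             else (fun i => if i is i'.+1 then t.1 i' else None, 0)
  | Stay => t
  | MoveR => (t.1, t.2.+1)
  end.

(** The left list has exactly as many cells as the head position, while the right list is only
    determined up to trailing blanks, hence the comparison through [nth None]. *)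
Definition represents (t : tape bool) (a : atape) : Prop :=
  [/\ lhs t = rev (mkseq a.1 a.2), scanned t = a.1 a.2 &
      forall i, nth None (rhs t) i = a.1 (a.2 + i).+1].

Lemma represents_act (t : tape bool) (a : atape) (w : option sym) (d : move) :
  represents t a ->
  represents (tape_move d (tape_write (if w is Some s then s else scanned t) t))
             (amove d (awrite w a)).
Proof.
case: t a => l s r [f p] [/= hl hs hr].
have {hl hs hr} : represents (Tape l (if w is Some s' then s' else s) r)
                     (awrite w (f, p)).
  case: w => [s'|] //=; split=> //=; last first.
  - by move=> i; case: eqP => [|_ //]; lia.
  - by rewrite eqxx.
  - rewrite hl; congr rev; apply/eq_in_map => i.
    by rewrite mem_iota; case: eqP => [->|//]; lia.
rewrite /tape_write /=.
move: (match w with Some s' => s' | None => s end) (awrite w (f, p)) => {w} s' [g q].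
case=> /= hl hs hr; case: d => /=.
- case: q hl hs hr => [|q] /= hl hs hr.
    by rewrite hl; split=> // -[|i] //=; rewrite ?hs ?hr.
  rewrite hl mkseqS rev_rcons /=; split=> // -[|i] /=.
    by rewrite addn0.
  by rewrite hr addnS.
- by split.
- case: r hr => [|b r] hr; split=> //=.
  + by rewrite mkseqS rev_rcons hl hs.
  + by rewrite -(addn0 q) -hr.
  + by move=> i; rewrite addSnnS -hr !nth_nil.
  + by rewrite mkseqS rev_rcons hl hs.
  + by rewrite -(addn0 q) -hr.
  + by move=> i; rewrite addSnnS -hr.
Qed.

(** * A structured language for multi-tape machines *)

Inductive stmt :=
  | Act of (nat -> option sym * move)
  | Seq of stmt & stmt
  | If of nat & pred sym & stmt & stmt
  | While of nat & pred sym & stmt.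

Notation "s ;; t" := (Seq s t) (at level 60, right associativity).

Fixpoint control (s : stmt) : finType :=
  match s with
  | Act _ => unit
  | Seq a b => (control a + control b)%type
  | If _ _ a b => option (control a + control b)%type
  | While _ _ a => option (control a)
  end.

Fixpoint entry (s : stmt) : control s :=
  match s with
  | Act _ => tt
  | Seq a _ => inl (entry a)
  | If _ _ _ _ => None
  | While _ _ _ => None
  end.

Definition idle : nat -> option sym * move := fun=> (None, Stay).

(* The successor state [None] means that control leaves the statement. *)
Fixpoint trans (s : stmt) (sc : nat -> sym) :
    control s -> option (control s) * (nat -> option sym * move) :=
  match s return control s -> option (control s) * (nat -> option sym * move) with
  | Act f => fun=> (None, f)
  | Seq a b => fun q =>
      match q with
      | inl q => let: (o, f) := trans sc q in
                 (Some (if o is Some q' then inl q' else inr (entry b)), f)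
      | inr q => let: (o, f) := trans sc q in (omap inr o, f)
      end
  | If j p a b => fun q =>
      match q with
      | None => (Some (Some (if p (sc j) then inl (entry a) else inr (entry b))),
                 idle)
      | Some (inl q) => let: (o, f) := trans sc q in (omap (Some \o inl) o, f)
      | Some (inr q) => let: (o, f) := trans sc q in (omap (Some \o inr) o, f)
      end
  | While j p a => fun q =>
      match q with
      | None => (if p (sc j) then Some (Some (entry a)) else None, idle)
      | Some q => let: (o, f) := trans sc q in (Some o, f)
      end
  end.

Definition perform (f : nat -> option sym * move) (x : store) : store :=
  fun j => amove (f j).2 (awrite (f j).1 (x j)).

Definition scan (x : store) : nat -> sym := fun j => ascan (x j).

Lemma perform_idle (x : store) : perform idle x = x.
Proof. by []. Qed.

Inductive reach (s : stmt) : control s -> store -> nat -> store -> Prop :=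
  | reach_exit q x f : trans (scan x) q = (None, f) ->
      reach q x 1 (perform f x)
  | reach_step q q' x f t y : trans (scan x) q = (Some q', f) ->
      reach q' (perform f x) t y -> reach q x t.+1 y.

Lemma reach_seqr a b (q : control b) x t y :
  reach q x t y -> @reach (Seq a b) (inr q) x t y.
Proof.
elim=> {q x t y} [q x f e|q q' x f t y e _ ih].
  by apply: reach_exit; rewrite /= e.
by apply: reach_step ih; rewrite /= e.
Qed.

Lemma reach_seq a b (q : control a) x t y t' z :
  reach q x t y -> reach (entry b) y t' z ->
  @reach (Seq a b) (inl q) x (t + t') z.
Proof.
move=> h; elim: h => {q x t y} [q x f e|q q' x f t y e _ ih] hb.
  by apply: (@reach_step (Seq a b) _ (inr (entry b)));
     [rewrite /= e|apply: reach_seqr].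
by apply: reach_step (ih hb); rewrite /= e.
Qed.

Lemma reach_ifl j p a b (q : control a) x t y :
  reach q x t y -> @reach (If j p a b) (Some (inl q)) x t y.
Proof.
elim=> {q x t y} [q x f e|q q' x f t y e _ ih].
  by apply: reach_exit; rewrite /= e.
by apply: reach_step ih; rewrite /= e.
Qed.

Lemma reach_ifr j p a b (q : control b) x t y :
  reach q x t y -> @reach (If j p a b) (Some (inr q)) x t y.
Proof.
elim=> {q x t y} [q x f e|q q' x f t y e _ ih].
  by apply: reach_exit; rewrite /= e.
by apply: reach_step ih; rewrite /= e.
Qed.

Lemma reach_while j p a (q : control a) x t y t' z :
  reach q x t y -> @reach (While j p a) None y t' z ->
  @reach (While j p a) (Some q) x (t + t') z.
Proof.
move=> h; elim: h => {q x t y} [q x f e|q q' x f t y e _ ih] hb.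
  by apply: (@reach_step (While j p a) _ None) hb; rewrite /= e.
by apply: reach_step (ih hb); rewrite /= e.
Qed.

(** An exponent of [L.+2]. For sequences, [u + v <= 2 * u * v] for positive [u], [v] costs one extra
    factor. For loops, one factor pays for the at most [L.+1] rounds and a second one for the steps
    spent on tests. *)
Fixpoint degree (s : stmt) : nat :=
  match s with
  | Act _ => 0
  | Seq a b => (degree a + degree b).+1
  | If _ _ a b => (degree a + degree b).+1
  | While _ _ a => (degree a).+2
  end.

(* The time bound is read off the syntax: every loop is only ever run for at
   most [L.+1] rounds. *)
Definition runs (L : nat) (s : stmt) (x y : store) : Prop :=
  exists2 t, t <= L.+2 ^ degree s & reach (entry s) x t y.

Lemma runs_act L f x : runs L (Act f) x (perform f x).
Proof. by exists 1 => //; apply: reach_exit. Qed.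

Lemma expn_gt0_base2 L k : 0 < L.+2 ^ k.
Proof. by rewrite expn_gt0. Qed.

Lemma leq_expD L a b : L.+2 ^ a + L.+2 ^ b <= L.+2 ^ (a + b).+1.
Proof.
rewrite expnS expnD.
have := expn_gt0_base2 L a; have := expn_gt0_base2 L b.
by move: (_ ^ a) (_ ^ b) => u v; nia.
Qed.

Lemma runs_seq L a b x y z :
  runs L a x y -> runs L b y z -> runs L (a ;; b) x z.
Proof.
move=> [t ht ha] [t' ht' hb]; exists (t + t'); last exact: reach_seq ha hb.
by apply: leq_trans (leq_expD _ _ _); apply: leq_add.
Qed.

Lemma runs_if L j (p : pred sym) a b x y :
  runs L (if p (ascan (x j)) then a else b) x y -> runs L (If j p a b) x y.
Proof.
move=> [t ht h]; exists t.+1.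
  have ha := expn_gt0_base2 L (degree a); have hb := expn_gt0_base2 L (degree b).
  apply: leq_trans (leq_expD _ _ _).
  by case: (p _) ht ha hb; move: (_ ^ degree a) (_ ^ degree b) => u v; lia.
apply: (@reach_step (If j p a b) _
  (Some (if p (ascan (x j)) then inl (entry a) else inr (entry b)))) => //=.
rewrite perform_idle; move: h; case: (p _) => h; first exact: reach_ifl.
exact: reach_ifr.
Qed.

Lemma runs_while L s j (p : pred sym) (f : nat -> store) m :
  m <= L.+1 -> (forall i, i < m -> p (ascan (f i j))) ->
  (forall i, i < m -> runs L s (f i) (f i.+1)) -> ~~ p (ascan (f m j)) ->
  runs L (While j p s) (f 0) (f m).
Proof.
move=> hm hp hs hn.
(* Induction on the number [k] of rounds still to run: each costs its body plus one test, and the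
   final [1] is the failing test. *)
have h k : k <= m -> exists2 t, t <= k * (L.+2 ^ degree s).+1 + 1 &
    @reach (While j p s) None (f (m - k)) t (f m).
  elim: k => [|k ih] hk.
    exists 1; rewrite // subn0 -{2}[f m]perform_idle.
    by apply: (@reach_exit (While j p s)); rewrite /= /scan (negPf hn).
  have [t ht h] := ih (ltnW hk).
  have hlt : m - k.+1 < m by lia.
  have [t' ht' h'] := hs _ hlt.
  exists (t' + t).+1; first by rewrite mulSn; lia.
  apply: (@reach_step (While j p s) _ (Some (entry s))) => /=.
    by rewrite /scan hp.
  rewrite perform_idle; apply: reach_while h' _.
  by have -> : (m - k.+1).+1 = m - k by lia.
have [t ht hr] := h m (leqnn _); exists t; last by rewrite subnn in hr.
apply: leq_trans ht _; rewrite /= !expnS.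
have := expn_gt0_base2 L (degree s); move: (_ ^ _) => u hu.
have : m * u.+1 <= L.+1 * u.+1 by rewrite leq_mul2r hm orbT.
nia.
Qed.

Fixpoint max_test (s : stmt) : nat :=
  match s with
  | Act _ => 0
  | Seq a b => maxn (max_test a) (max_test b)
  | If j _ a b => maxn j (maxn (max_test a) (max_test b))
  | While j _ a => maxn j (max_test a)
  end.

(** This is what lets finitely many tapes replace an infinite store: actions on tapes beyond the
    last tested one cannot influence the control, so the compiler may drop those tapes. *)
Lemma trans_ext s sc sc' (q : control s) :
  (forall j, j <= max_test s -> sc j = sc' j) -> @trans s sc q = @trans s sc' q.
Proof.
elim: s q => [f|a iha b ihb|j p a iha b ihb|j p a iha] //= q h.
- by case: q => q; rewrite ?iha ?ihb // => j hj; apply: h; rewrite leq_max hj ?orbT.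
- case: q => [[q|q]|]; rewrite ?h ?leq_max ?leqnn // ?iha ?ihb // => k hk;
    by apply: h; rewrite !leq_max hk ?orbT.
- case: q => [q|]; rewrite ?h ?leq_max ?leqnn // ?iha // => k hk.
  by apply: h; rewrite !leq_max hk ?orbT.
Qed.

(* The output tape of a machine must be its last one; programs write their
   output to tape 3, which the compiler exchanges with the last tape. *)
Definition last_tape (s : stmt) : nat := maxn 4 (max_test s).

Definition place (s : stmt) (j : nat) : nat :=
  if j == 3 then last_tape s else if j == last_tape s then 3 else j.

Lemma place_le s j : j <= last_tape s -> place s j <= last_tape s.
Proof.
by rewrite /place; have : 4 <= last_tape s by [rewrite leq_max leqnn];
   do ?case: eqP => ?; lia.
Qed.

Lemma placeK s : involutive (place s).
Proof.
have h : 4 <= last_tape s by rewrite leq_max leqnn.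
move=> j; rewrite /place; move: (last_tape s) h => K h.
case: (j =P 3) => [->|h3]; first by rewrite eqxx; case: (K =P 3) => ?; lia.
by case: (j =P K) => [->|hK] //=; do ?case: eqP => ?; lia.
Qed.

Lemma place_eq0 s j : (place s j == 0) = (j == 0).
Proof.
have h : 4 <= last_tape s by rewrite leq_max leqnn.
rewrite /place; move: (last_tape s) h => K h.
by case: (j =P 3) => ?; case: (j =P K) => ?; lia.
Qed.

Lemma place_last s : place s (last_tape s) = 3.
Proof.
have h : 4 <= last_tape s by rewrite leq_max leqnn.
by rewrite /place eqxx; case: eqP => ?; lia.
Qed.

Definition compile (s : stmt) : machine :=
  @Machine (last_tape s) bool (option (control s)) (Some (entry s)) (fun q => ~~ q)
    (fun q sc =>
       if q is Some q' then
         let: (o, f) := trans (fun j => sc (inord (place s j))) q' in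
         (o, [ffun i : 'I_(last_tape s).+1 =>
                let: (w, d) := f (place s i) in
                (if w is Some a then a else sc i, d)])
       else (q, [ffun i => (sc i, Stay)])).

Definition matches s (c : config (compile s)) (x : store) : Prop :=
  forall i : 'I_(last_tape s).+1, represents (ctapes c i) (x (place s i)).

Lemma step_compile s (c : config (compile s)) q x o f :
  cstate c = Some q -> matches c x -> trans (scan x) q = (o, f) ->
  cstate (step c) = o /\ matches (step c) (perform f x).
Proof.
case: c => q' tp /= -> hx e; rewrite /step /=.
have -> : trans (fun j => [ffun i => scanned (tp i)] (inord (place s j))) q = (o, f).
  rewrite -e; apply: trans_ext => j hj; rewrite ffunE.
  have hj' : j <= last_tape s by rewrite leq_max hj orbT.
  have [_ -> _] := hx (inord (place s j)).
  by rewrite inordK ?ltnS ?place_le // placeK.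
split=> // i; rewrite /= !ffunE /perform.
have := hx i; case: (f (place s i)) => w d /= hi.
exact: represents_act.
Qed.

Lemma iter_compile s (c : config (compile s)) q x t y :
  cstate c = Some q -> matches c x -> reach q x t y ->
  halted (iter t (@step (compile s)) c) /\
  matches (iter t (@step (compile s)) c) y.
Proof.
move=> hc hx h; elim: h c hc hx => {q x t y} [q x f e|q q' x f t y e _ ih] c hc hx.
  by have [h1 h2] := step_compile hc hx e; split; rewrite //= /halted h1.
have [h1 h2] := step_compile hc hx e.
by rewrite iterSr; apply: ih.
Qed.

Definition initial_store (w : seq bool) : store :=
  fun j => (fun i => if j == 0 then omap inl (onth w i) else None, 0).

Lemma matches_initial s w : matches (initial (compile s) w) (initial_store w).
Proof.
move=> i; rewrite /= ffunE /initial_store.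
have -> : (place s i == 0) = (i == ord0).
  by rewrite place_eq0.
case: (i == ord0) => /=; last by split=> // k; rewrite nth_nil.
case: w => [|b w] //=; split=> // k; rewrite ?nth_nil //= add0n.
by rewrite onthE; elim: w k => [|b' w ih] [|k] //=.
Qed.

Lemma leading_bits_mkseq (G : finType) (s : seq (symbol G)) (b : nat -> bool) H :
  (forall i, nth None s i = if i < H then Some (inl (b i)) else None) ->
  leading_bits s = mkseq b H.
Proof.
elim: H s b => [|H ih] s b h.
  by case: s h => [|a s] //= h; have /= -> := h 0.
case: s h => [|a s] //= h; first by have := h 0.
have /= -> := h 0; rewrite /mkseq /= (iotaDl 1 0) -map_comp; congr cons.
by apply: (ih s (b \o S)) => i; have /= -> := h i.+1.
Qed.

Lemma computes_within_compile L s w y (b : nat -> bool) H :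
  runs L s (initial_store w) y ->
  (forall i, (y 3).1 ((y 3).2 + i) = if i < H then Some (inl (b i)) else None) ->
  computes_within (compile s) w (L.+2 ^ degree s) (mkseq b H).
Proof.
move=> [t ht h] hy; exists t.
have [hh hm] := iter_compile (c := initial (compile s) w) erefl (matches_initial w) h.
split=> //; apply: leading_bits_mkseq => i.
have [_ h2 h3] := hm ord_max.
move: h2 h3; rewrite /= place_last => h2 h3.
by case: i => [|i] /=; rewrite ?h2 ?h3 -hy ?addn0 ?addnS.
Qed.

(** * Registers and arrays on tapes *)

(* Tapes 0 to 3 hold arrays of bits, with entry [i] in cell [i.+1]. Every other
   tape is a register, whose value is the position of its head; it has end
   markers in cells [0] and [L]. *)
Definition array_cells (f : nat -> option bool) : nat -> sym :=
  fun i => if i is i'.+1 then omap inl (f i') else left_end.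

Definition register_cells (L : nat) : nat -> sym :=
  fun i => if i == 0 then left_end else if i == L then right_end else None.

Definition layout (L : nat) (A : nat -> nat -> option bool) (p : nat -> nat) :
    store :=
  fun j => (if j < 4 then array_cells (A j) else register_cells L, p j).

Definition upd (T : Type) (p : nat -> T) (j : nat) (v : T) : nat -> T :=
  fun i => if i == j then v else p i.

Definition not_left : pred sym := fun s => s != left_end.
Definition not_right : pred sym := fun s => s != right_end.
Definition is_one : pred sym := fun s => s == Some (inl true).

Definition skip := Act idle.
Definition move_heads (f : nat -> move) := Act (fun j => (None, f j)).
Definition inc j := move_heads (fun i => if i == j then MoveR else Stay).
Definition dec j := move_heads (fun i => if i == j then MoveL else Stay).
Definition write_bit a b :=
  Act (fun i => (if i == a then Some (Some (inl b)) else None, Stay)).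
Definition transfer src (g : pred nat) :=
  While src not_left (move_heads
    (fun j => if j == src then MoveL else if g j then MoveR else Stay)).
Definition zero j := transfer j pred0.
(** Reading a register by counting it down destroys it, so its value is sent to two registers and
    one of them is poured back. *)
Definition copy src dst tmp :=
  transfer src (pred2 dst tmp) ;; transfer tmp (pred1 src).
Definition saturating_add src dst :=
  While src not_left (dec src ;; If dst not_right (inc dst) skip).

Ltac regs :=
  let k := fresh "k" in
  try congr (layout _ _ _); apply: functional_extensionality => k;
  rewrite /upd /=; repeat (case: eqP => ?); subst => //=; try lia.

Section Macros.

Variables (L : nat) (A : nat -> nat -> option bool).
Implicit Types (p : nat -> nat) (j : nat).

Lemma runs_eq s x y y' : runs L s x y -> y = y' -> runs L s x y'.
Proof. by move=> h <-. Qed.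

Lemma layout_not_left p j : not_left (ascan (layout L A p j)) = (0 < p j).
Proof.
rewrite /not_left /ascan /=; case: (j < 4); case: (p j) => [|i] //=.
  by case: (A j i).
by rewrite /register_cells /=; case: (_ == L).
Qed.

Lemma layout_not_right p j :
  0 < L -> 3 < j -> not_right (ascan (layout L A p j)) = (p j != L).
Proof.
move=> hL hj; rewrite /not_right /ascan /= ltnNge hj /= /register_cells.
by case: (p j) => [|i] /=; [lia|case: (_ == L)].
Qed.

Lemma layout_is_one p a i :
  a < 4 -> p a = i.+1 -> is_one (ascan (layout L A p a)) = (A a i == Some true).
Proof.
by move=> ha hi; rewrite /is_one /ascan /= ha hi /=; case: (A a i) => [[]|].
Qed.

Lemma runs_skip x : runs L skip x x.
Proof. exact: runs_act. Qed.

Lemma runs_move_heads f p : (forall j, f j = MoveL -> 0 < p j) ->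
  runs L (move_heads f) (layout L A p)
    (layout L A (fun j => match f j with
                          | MoveL => (p j).-1 | Stay => p j | MoveR => (p j).+1
                          end)).
Proof.
move=> h; apply: (runs_eq (runs_act _ _ _)); apply: functional_extensionality => j.
rewrite /perform /layout /=; case e: (f j) => //=.
by case: (p j) (h j e).
Qed.

Lemma runs_inc p j :
  runs L (inc j) (layout L A p) (layout L A (upd p j (p j).+1)).
Proof. by apply: runs_eq (runs_move_heads _) _ => [k|]; [case: eqP|regs]. Qed.

Lemma runs_dec p j : 0 < p j ->
  runs L (dec j) (layout L A p) (layout L A (upd p j (p j).-1)).
Proof.
by move=> h; apply: runs_eq (runs_move_heads _) _ => [k|]; [case: eqP => [->|]|regs].
Qed.

(** The bound is [L.+1] rather than [L] because the head of an array stands one cell to the right of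
    the index, and a computed index may equal [L]. *)
Lemma runs_transfer p src g : p src <= L.+1 ->
  runs L (transfer src g) (layout L A p)
    (layout L A (fun j => if j == src then 0
                          else if g j then p j + p src else p j)).
Proof.
move=> hs.
pose f i := layout L A (fun j => if j == src then p j - i
                                 else if g j then p j + i else p j).
have -> : layout L A p = f 0.
  by rewrite /f; regs; case: (g k); lia.
apply: runs_eq (runs_while (f := f) (m := p src) hs _ _ _) _.
- by move=> i hi; rewrite layout_not_left eqxx subn_gt0.
- move=> i hi; apply: runs_eq (runs_move_heads _) _ => [k|].
    by case: eqP => [-> _|]; [lia|case: (g k)].
  by rewrite /f; regs; case: (g k); lia.
- by rewrite layout_not_left eqxx subnn.
- by rewrite /f; regs.
Qed.

Lemma runs_zero p j : p j <= L.+1 ->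
  runs L (zero j) (layout L A p) (layout L A (upd p j 0)).
Proof. by move=> h; apply: runs_eq (runs_transfer _ h) _; regs. Qed.

Lemma runs_copy p src dst tmp :
  p src <= L -> p dst = 0 -> p tmp = 0 -> uniq [:: src; dst; tmp] ->
  runs L (copy src dst tmp) (layout L A p) (layout L A (upd p dst (p src))).
Proof.
rewrite /= !inE negb_or !andbT => hs hd ht /andP[/andP[h1 h2] h3].
apply: runs_seq; first by apply: runs_transfer; lia.
apply: runs_eq (runs_transfer _ _) _.
  by rewrite eq_sym (negPf h2) /= eqxx orbT; lia.
by rewrite /= !eqxx; regs.
Qed.

Lemma runs_saturating_add p src dst :
  0 < L -> 3 < dst -> src != dst -> p src <= L -> p dst <= L ->
  runs L (saturating_add src dst) (layout L A p)
    (layout L A (upd (upd p src 0) dst (minn (p dst + p src) L))).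
Proof.
move=> h0 hd hsd hs hL.
pose f i := layout L A (upd (upd p src (p src - i)) dst (minn (p dst + i) L)).
have -> : layout L A p = f 0 by rewrite /f; regs.
apply: runs_eq (runs_while (f := f) (m := p src) _ _ _ _) _; first by lia.
- by move=> i hi; rewrite layout_not_left /upd (negPf hsd) eqxx subn_gt0.
- move=> i hi; apply: runs_seq.
    by apply: runs_dec; rewrite /upd (negPf hsd) eqxx subn_gt0.
  apply: runs_if; rewrite layout_not_right // /upd [dst == src]eq_sym.
  rewrite (negPf hsd) eqxx; case: (_ =P L) => /= h.
    by apply: runs_eq (runs_skip _) _; rewrite /f; regs.
  by apply: runs_eq (runs_inc _ _) _; rewrite /f; regs.
- by rewrite layout_not_left /upd (negPf hsd) eqxx subnn.
- by rewrite /f; regs.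
Qed.

End Macros.

(** * Expressions *)

(* Variables are de Bruijn indices, [Count e] binds a variable ranging over
   [0 .. L - 1], and nonzero values stand for truth. *)
Inductive expr :=
  | Var of nat
  | One
  | Add of expr & expr
  | Mul of expr & expr
  | Lt of expr & expr
  | Rd of bool & expr
  | Count of expr.

Fixpoint eval (L : nat) (rd : bool -> nat -> bool) (env : seq nat) (e : expr) :
    nat :=
  match e with
  | Var k => nth 0 env k
  | One => 1
  | Add a b => minn (eval L rd env a + eval L rd env b) L
  | Mul a b => minn (eval L rd env a * eval L rd env b) L
  | Lt a b => eval L rd env a < eval L rd env b
  | Rd b e => rd b (eval L rd env e)
  | Count e => count (fun i => 0 < eval L rd (i :: env) e) (iota 0 L)
  end.

Lemma eval_le L rd env e :
  0 < L -> all (fun v => v <= L) env -> eval L rd env e <= L.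
Proof.
move=> hL henv; case: e => //=; try by move=> *; lia.
- move=> k; case: (ltnP k (size env)) => hk; last by rewrite nth_default.
  exact: (allP henv) (mem_nth _ hk).
- by move=> e; apply: leq_trans (count_size _ _) _; rewrite size_iota.
Qed.

(* The value of [e] is pushed into register [r]; the variables live in the
   registers [vs], and all registers from [r] on are initially zero. *)
Fixpoint push (vs : seq nat) (r : nat) (e : expr) : stmt :=
  match e with
  | Var k => if k < size vs then copy (nth 0 vs k) r r.+1 else skip
  | One => inc r
  | Add a b => push vs r a ;; push vs r.+1 b ;; saturating_add r.+1 r
  | Mul a b =>
      push vs r a ;; push vs r.+1 b ;;
      While r not_left
        (dec r ;; copy r.+1 r.+3 r.+4 ;; saturating_add r.+3 r.+2) ;;
      zero r.+1 ;; transfer r.+2 (pred1 r)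
  | Lt a b =>
      push vs r a ;; push vs r.+1 b ;;
      While r not_left (dec r ;; If r.+1 not_left (dec r.+1) skip) ;;
      If r.+1 not_left (zero r.+1 ;; inc r) skip
  | Rd b e =>
      push vs r e ;; transfer r (pred1 (b : nat)) ;; inc b ;;
      If b is_one (inc r) skip ;; zero b
  | Count e =>
      While r.+1 not_right
        (push (r.+1 :: vs) r.+2 e ;;
         If r.+2 not_left (zero r.+2 ;; inc r) skip ;; inc r.+1) ;;
      zero r.+1
  end.

Record stack_ok (L : nat) (vs : seq nat) (r : nat) (p : nat -> nat) : Prop :=
  StackOk {
    stack_base : 3 < r;
    stack_le : forall j, p j <= L;
    stack_arrays : forall j, j < 4 -> p j = 0;
    stack_free : forall j, r <= j -> p j = 0;
    stack_vars : all (fun v => 3 < v < r) vs }.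

Lemma stack_ok_push L vs r p v :
  v <= L -> stack_ok L vs r p -> stack_ok L vs r.+1 (upd p r v).
Proof.
move=> hv [h1 h2 h3 h4 h5]; split=> [|j|j hj|j hj|]; rewrite ?/upd.
- exact: ltnW.
- by case: eqP.
- by case: eqP => [e|_]; [lia|apply: h3].
- by case: eqP => [e|_]; [lia|apply: h4; lia].
- by apply: sub_all h5 => k; lia.
Qed.

Lemma stack_ok_bind L vs r p : stack_ok L vs r.+1 p -> 3 < r ->
  stack_ok L (r :: vs) r.+1 p.
Proof. by case=> h1 h2 h3 h4 h5 h; split=> //=; rewrite h5 h ltnSn. Qed.

Lemma map_upd vs r (p : nat -> nat) v :
  all (fun k => 3 < k < r) vs -> map (upd p r v) vs = map p vs.
Proof.
move=> h; apply/eq_in_map => k /(allP h) hk; rewrite /upd.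
by case: eqP => // e; lia.
Qed.

(** The coercion of [b] selects array 0 (the input) or array 1 (the memory); a blank entry reads as
    false. *)
Definition bits (A : nat -> nat -> option bool) (b : bool) (i : nat) : bool :=
  A b i == Some true.

Lemma runs_push L A vs r e p : 0 < L -> stack_ok L vs r p ->
  runs L (push vs r e) (layout L A p)
    (layout L A (upd p r (eval L (bits A) (map p vs) e))).
Proof.
move=> hL.
have ev_le vs' r' p' e' : stack_ok L vs' r' p' ->
    eval L (bits A) (map p' vs') e' <= L.
  move=> h; apply: eval_le => //; rewrite all_map; apply/allP => k _ /=.
  exact: stack_le h _.
(* The common start of [Add], [Mul] and [Lt], taking the two induction hypotheses as premises: both
   operands are on the stack before [s] runs. *)
have push2 a b :
    (forall vs r p, stack_ok L vs r p -> runs L (push vs r a) (layout L A p)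
       (layout L A (upd p r (eval L (bits A) (map p vs) a)))) ->
    (forall vs r p, stack_ok L vs r p -> runs L (push vs r b) (layout L A p)
       (layout L A (upd p r (eval L (bits A) (map p vs) b)))) ->
    forall s y vs r p, stack_ok L vs r p ->
    let va := eval L (bits A) (map p vs) a in
    let vb := eval L (bits A) (map p vs) b in
    (va <= L -> vb <= L ->
     runs L s (layout L A (upd (upd p r va) r.+1 vb)) y) ->
    runs L (push vs r a ;; push vs r.+1 b ;; s) (layout L A p) y.
  move=> ha hb s y vs' r' p' hp va vb hs.
  have hva : va <= L := ev_le _ _ _ _ hp.
  have hvb : vb <= L := ev_le _ _ _ _ hp.
  apply: runs_seq (ha _ _ _ hp) _; apply: runs_seq.
    exact: (hb _ _ _ (stack_ok_push hva hp)).
  by rewrite map_upd; [apply: hs|case: hp].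
elim: e vs r p => [k||a iha b ihb|a iha b ihb|a iha b ihb|b e ih|e ih] vs r p hp.
- rewrite /=; case: ltnP => hk; last first.
    rewrite nth_default ?size_map //; apply: runs_eq (runs_skip _ _) _.
    by regs; rewrite (stack_free hp).
  have hv : 3 < nth 0 vs k < r := allP (stack_vars hp) _ (mem_nth _ hk).
  rewrite (nth_map 0) //; apply: runs_copy.
  + exact: stack_le hp _.
  + exact: stack_free hp _ _.
  + by apply: stack_free hp _ _.
  + by rewrite /= !inE; lia.
- apply: runs_eq (runs_inc _ _ _ _) _; regs.
  by rewrite (stack_free hp).
- apply: (push2 _ _ iha ihb _ _ _ _ _ hp) => hva hvb.
  apply: runs_eq (runs_saturating_add _ _ _ _ _ _) _ => //.
  + exact: stack_base hp.
  + by lia.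
  + by rewrite /upd eqxx.
  + by rewrite /upd; do ?case: eqP => ?; lia.
  + rewrite /=; regs; rewrite ?(stack_free hp); lia.
- apply: (push2 _ _ iha ihb _ _ _ _ _ hp) => /=.
  move: (eval _ _ _ a) (eval _ _ _ b) => va vb hva hvb.
  have hr := stack_base hp; have hz := stack_free hp.
  (* Repeated saturating addition: truncating at [L] in every round gives the same result as
     truncating the product once. *)
  pose f i := layout L A (upd (upd (upd p r (va - i)) r.+1 vb) r.+2 (minn (i * vb) L)).
  have hm : minn (va * vb) L <= L by lia.
  apply: (@runs_seq _ _ _ _ (f va)).
    have -> : layout L A (upd (upd p r va) r.+1 vb) = f 0.
      by rewrite /f; regs; rewrite hz; lia.
    apply: runs_while; first by lia.
    + by move=> i hi; rewrite layout_not_left // /upd; do ?case: eqP => ?; lia.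
    + move=> i hi; apply: runs_seq.
        by apply: runs_dec => //; rewrite /upd; do ?case: eqP => ?; lia.
      apply: runs_seq.
        apply: runs_copy; rewrite /= ?inE; try lia;
          by rewrite /upd; do ?case: eqP => ?; try lia; rewrite hz; lia.
      apply: runs_eq (runs_saturating_add _ _ _ _ _ _) _ => //; try lia.
      1,2: by rewrite /upd; do ?case: eqP => ?; try lia; rewrite hz; lia.
      by rewrite /f; regs; rewrite ?mulSn ?hz; lia.
    + by rewrite layout_not_left // /upd; do ?case: eqP => ?; lia.
  apply: runs_seq.
    by apply: runs_zero => //; rewrite /upd; do ?case: eqP => ?; lia.
  apply: runs_eq (runs_transfer _ _ _) _ => //.
    by rewrite /upd; do ?case: eqP => ?; lia.
  by rewrite /=; regs; rewrite ?hz; lia.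
- apply: (push2 _ _ iha ihb _ _ _ _ _ hp) => /=.
  move: (eval _ _ _ a) (eval _ _ _ b) => va vb hva hvb.
  have hr := stack_base hp; have hz := stack_free hp.
  (* Both registers are decremented with truncation; what finally remains is [vb - va], positive
     exactly when [va < vb]. *)
  pose f i := layout L A (upd (upd p r (va - i)) r.+1 (vb - i)).
  apply: (@runs_seq _ _ _ _ (f va)).
    have -> : layout L A (upd (upd p r va) r.+1 vb) = f 0 by rewrite /f; regs.
    apply: runs_while; first by lia.
    + by move=> i hi; rewrite layout_not_left // /upd; do ?case: eqP => ?; lia.
    + move=> i hi; apply: runs_seq.
        by apply: runs_dec => //; rewrite /upd; do ?case: eqP => ?; lia.
      apply: runs_if; rewrite layout_not_left //; case: ltnP => h.
        by apply: runs_eq (runs_dec _ _ _) _ => //; rewrite /f; regs.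
      apply: runs_eq (runs_skip _ _) _; rewrite /f; move: h.
      by rewrite /upd; do ?case: eqP => ?; try lia; move=> h; regs.
    + by rewrite layout_not_left // /upd; do ?case: eqP => ?; lia.
  apply: runs_if; rewrite layout_not_left //.
  have -> : upd (upd p r (va - va)) r.+1 (vb - va) r.+1 = vb - va.
    by rewrite /upd eqxx.
  rewrite subn_gt0; case: ltnP => h.
    apply: runs_seq.
      by apply: runs_zero => //; rewrite /upd; do ?case: eqP => ?; lia.
    by apply: runs_eq (runs_inc _ _ _ _) _; regs; rewrite ?hz; lia.
  by apply: runs_eq (runs_skip _ _) _; rewrite /f; regs; rewrite ?hz; lia.
- have hr := stack_base hp; have hz := stack_free hp; have ha := stack_arrays hp.
  apply: runs_seq (ih _ _ _ hp) _ => /=.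
  move: (eval _ _ _ e) (ev_le _ _ _ e hp) => v hv.
  rewrite {ih}/bits; have : (b : nat) < 4 by case: b.
  move: (b : nat) => a h4.
  apply: (@runs_seq _ _ _ _ (layout L A (upd p a v))).
    apply: runs_eq (runs_transfer _ _ _) _; first by rewrite /upd eqxx; lia.
    by regs; [rewrite hz|rewrite ha].
  apply: runs_seq; first exact: runs_inc.
  rewrite /upd eqxx -/(upd _ _ _).
  apply: (@runs_seq _ _ _ _ (layout L A (upd (upd p r (A a v == Some true)) a v.+1))).
    apply: runs_if; rewrite (@layout_is_one _ _ _ _ v) ?/upd ?eqxx //.
    case: eqP => _.
      by apply: runs_eq (runs_inc _ _ _ _) _; regs; rewrite ?hz; lia.
    by apply: runs_eq (runs_skip _ _) _; regs; rewrite ?hz; lia.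
  apply: runs_eq (runs_zero _ _) _; first by rewrite /upd eqxx; lia.
  by regs; rewrite ?ha.
- have hr := stack_base hp; have hz := stack_free hp; have hl := stack_le hp.
  pose P i := 0 < eval L (bits A) (i :: map p vs) e.
  (* Register [r] holds the running count and [r.+1] the bound variable, so the body is evaluated
     from [r.+2] on. *)
  pose q i := upd (upd p r (count P (iota 0 i))) r.+1 i.
  have hc i : count P (iota 0 i) <= i.
    by apply: leq_trans (count_size _ _) _; rewrite size_iota.
  have hq i : i < L -> stack_ok L (r.+1 :: vs) r.+2 (q i).
    move=> hi; apply: stack_ok_bind; last by lia.
    apply: stack_ok_push; first exact: ltnW.
    by apply: stack_ok_push => //; have := hc i; lia.
  rewrite /= -/P; apply: (@runs_seq _ _ _ _ (layout L A (q L))).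
    have -> : layout L A p = layout L A (q 0).
      by rewrite /q; regs; rewrite hz.
    apply: (runs_while (f := fun i => layout L A (q i))) => // [i hi|i hi|].
    + by rewrite layout_not_right ?/q ?/upd ?eqxx //; lia.
    + have hqi := hq i hi.
      apply: runs_seq (ih _ _ _ hqi) _.
      have -> : eval L (bits A) (map (q i) (r.+1 :: vs)) e =
                eval L (bits A) (i :: map p vs) e.
        rewrite /= /q !map_upd ?(stack_vars hp) //; first by rewrite /upd eqxx.
        by apply: sub_all (stack_vars hp) => k; lia.
      set v := eval _ _ _ _; have hv : v <= L.
        apply: eval_le => //=; rewrite ltnW //= all_map.
        by apply/allP => k _ /=.
      apply: (@runs_seq _ _ _ _
               (layout L A (upd (upd p r (count P (iota 0 i.+1))) r.+1 i))).
        have hS : count P (iota 0 i.+1) = count P (iota 0 i) + (0 < v).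
          by rewrite -addn1 iotaD count_cat /= addn0.
        apply: runs_if; rewrite layout_not_left.
        have -> : upd (q i) r.+2 v r.+2 = v by rewrite /upd eqxx.
        rewrite hS; case: ltnP => h0.
          apply: runs_seq; first by apply: runs_zero; rewrite /upd eqxx; lia.
          by apply: runs_eq (runs_inc _ _ _ _) _; rewrite /q; regs; rewrite ?hz; lia.
        by apply: runs_eq (runs_skip _ _) _; rewrite /q; regs; rewrite ?hz; lia.
      by apply: runs_eq (runs_inc _ _ _ _) _; rewrite /q; regs.
    + by rewrite layout_not_right ?/q ?/upd ?eqxx //; lia.
  apply: runs_eq (runs_zero _ _) _; first by rewrite /q /upd eqxx; lia.
  by rewrite /q; regs; rewrite hz.
Qed.

(** * Iterating a definable update of a bit array *)

Definition not_blank : pred sym := fun s => s != None.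

(* Array [a] receives at each index [x] satisfying [g] the truth value of [e];
   as [e] can only read arrays 0 and 1, for [1 < a] the order of the writes is
   irrelevant. *)
Definition fill a vs r g e :=
  While r not_right
    (push (r :: vs) r.+1 g ;;
     If r.+1 not_left
       (zero r.+1 ;; push (r :: vs) r.+1 e ;;
        copy r r.+2 r.+3 ;; transfer r.+2 (pred1 a) ;; inc a ;;
        If r.+1 not_left (write_bit a true) (write_bit a false) ;;
        zero a ;; zero r.+1)
       skip ;;
     inc r) ;;
  zero r.

(** Array 2 is a second buffer: a round computes into it while reading array 1 and copies it back
    only at the end. Its first blank cell stops the loop. *)
Definition commit :=
  inc 1 ;; inc 2 ;;
  While 2 not_blank
    (If 2 is_one (write_bit 1 true) (write_bit 1 false) ;; inc 1 ;; inc 2) ;;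
  zero 1 ;; zero 2.

Definition along_registers (d : move) :=
  move_heads (fun j => if (j == 0) || (3 < j) then d else Stay).

(** One left move on every tape creates the cell 0 that receives the left marker. The registers then
    advance together with the head that sweeps the input, so they stand at [L] when it meets the
    blank; this is where the right marker is written. The input head, one cell ahead, is stepped
    back before all return. *)
Definition setup :=
  Act (fun=> (None, MoveL)) ;; Act (fun=> (Some left_end, Stay)) ;;
  inc 0 ;; While 0 not_blank (along_registers MoveR) ;;
  Act (fun j => (if 3 < j then Some right_end else None, Stay)) ;;
  dec 0 ;; While 0 not_left (along_registers MoveL).

(** Register 4 counts the rounds and is visible to [phi] as its second variable. The guard [g]
    limits the output to its true length, the next cell staying blank; the last [inc] steps over the
    left marker. *)
Definition program phi g psi :=
  setup ;;
  While 4 not_right (fill 2 [:: 4] 5 One phi ;; commit ;; inc 4) ;; zero 4 ;;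
  fill 3 [::] 4 g psi ;; inc 3.

Definition set_array (A : nat -> nat -> option bool) a n (G V : pred nat) :=
  fun c i => if [&& c == a, i < n & G i] then Some (V i) else A c i.

Definition truth L rd env e : bool := 0 < eval L rd env e.

Lemma runs_write_bit L A p a b i : a < 4 -> p a = i.+1 ->
  runs L (write_bit a b) (layout L A p)
    (layout L (fun c k => if (c == a) && (k == i) then Some b else A c k) p).
Proof.
move=> ha hp; apply: (runs_eq (runs_act _ _ _)).
apply: functional_extensionality => c; rewrite /perform /layout /=.
case: eqP => [->|_] //=; rewrite ha /= hp; congr pair.
by apply: functional_extensionality => -[|k] //=; rewrite eqSS; case: eqP.
Qed.

Lemma bits_set_array A a n G V : 1 < a -> bits (set_array A a n G V) = bits A.
Proof.
move=> ha; apply: functional_extensionality => b.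
apply: functional_extensionality => i; rewrite /bits /set_array.
by case: (_ =P a) => //; case: b => /= e; lia.
Qed.

Lemma runs_fill L A a vs r g e p : 0 < L -> 1 < a < 4 -> stack_ok L vs r p ->
  runs L (fill a vs r g e) (layout L A p)
    (layout L (set_array A a L
       (fun i => truth L (bits A) (i :: map p vs) g)
       (fun i => truth L (bits A) (i :: map p vs) e)) p).
Proof.
move=> hL ha hp; have hr := stack_base hp; have hz := stack_free hp.
have h0 := stack_arrays hp.
set G := fun i => _; set V := fun i => _.
pose f i := layout L (set_array A a i G V) (upd p r i).
have hq i : i < L -> stack_ok L (r :: vs) r.+1 (upd p r i).
  by move=> hi; apply: stack_ok_bind => //; apply: stack_ok_push hp; exact: ltnW.
have hev A' i e' : bits A' = bits A ->
    eval L (bits A') (map (upd p r i) (r :: vs)) e' =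
    eval L (bits A) (i :: map p vs) e'.
  by move=> -> /=; rewrite map_upd ?(stack_vars hp) // /upd eqxx.
have hle i e' : i < L -> eval L (bits A) (i :: map p vs) e' <= L.
  move=> hi; rewrite -(hev A) //; apply: eval_le => //; rewrite all_map.
  by apply/allP => k _ /=; apply: stack_le (hq i hi) _.
rewrite /fill; apply: (@runs_seq _ _ _ _ (f L)).
  have -> : layout L A p = f 0.
    rewrite /f (_ : upd p r 0 = p); last first.
      by apply: functional_extensionality => k; rewrite /upd; case: eqP => // ->; rewrite hz.
    congr (layout _ _ _); apply: functional_extensionality => c.
    by apply: functional_extensionality => i; rewrite /set_array /= andbF.
  apply: runs_while => // [i hi|i hi|].
  - by rewrite layout_not_right // /upd eqxx; lia.
  - have hb : bits (set_array A a i G V) = bits A by apply: bits_set_array; lia.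
    apply: runs_seq; first exact: runs_push (hq i hi).
    rewrite hev //; apply: (@runs_seq _ _ _ _
      (layout L (set_array A a i.+1 G V) (upd p r i))); last first.
      by apply: runs_eq (runs_inc _ _ _ _) _; rewrite /f; regs.
    have hS : set_array A a i.+1 G V = fun c k =>
        if G i && ((c == a) && (k == i)) then Some (V i) else set_array A a i G V c k.
      apply: functional_extensionality => c; apply: functional_extensionality => k.
      rewrite /set_array ltnS; case: (c == a); rewrite ?andbF //=.
      by case: (ltngtP k i) => [||->]; rewrite ?andbF ?andbT //= andbC.
    apply: runs_if; rewrite layout_not_left {1}/upd eqxx -/(truth _ _ _ _) -/(G i).
    have := hle i g hi; case hG: (G i) hS => /= hS hg; last first.
      apply: runs_eq (runs_skip _ _) _; rewrite hS; regs.
      by move: hG; rewrite /G /truth hz //; lia.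
    apply: runs_seq; first by apply: runs_zero; rewrite /upd eqxx; lia.
    have -> : upd (upd (upd p r i) r.+1 (eval L (bits A) (i :: map p vs) g)) r.+1 0
              = upd p r i.
      by regs; rewrite hz; lia.
    apply: runs_seq; first exact: runs_push (hq i hi).
    rewrite hev //; have := hle i e hi.
    set v := eval _ _ _ e => hv; have hV : V i = (0 < v) by [].
    apply: (@runs_seq _ _ _ _ (layout L (set_array A a i G V)
             (upd (upd (upd p r i) r.+1 v) r.+2 i))).
      apply: runs_eq (runs_copy _ _ _ _ _) _; rewrite ?/upd /= ?inE ?eqxx;
        try by [do ?case: eqP => ?; rewrite ?hz; lia].
      by regs.
    apply: (@runs_seq _ _ _ _ (layout L (set_array A a i G V)
             (upd (upd (upd p r i) r.+1 v) a i))).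
      apply: runs_eq (runs_transfer _ _ _) _; first by rewrite /upd eqxx; lia.
      by regs; first [rewrite hz; lia|rewrite h0; lia].
    apply: (@runs_seq _ _ _ _ (layout L (set_array A a i G V)
             (upd (upd (upd p r i) r.+1 v) a i.+1))).
      by apply: runs_eq (runs_inc _ _ _ _) _; regs.
    apply: (@runs_seq _ _ _ _ (layout L (set_array A a i.+1 G V)
             (upd (upd (upd p r i) r.+1 v) a i.+1))).
      apply: runs_if; rewrite layout_not_left.
      have -> : upd (upd (upd p r i) r.+1 v) a i.+1 r.+1 = v.
        by rewrite /upd; do ?case: eqP => ?; lia.
      rewrite hS hV; case: (0 < v); apply: (@runs_write_bit _ _ _ _ _ i);
        rewrite /upd ?eqxx; lia.
    apply: runs_seq.
      by apply: runs_zero; rewrite /upd eqxx; lia.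
    apply: runs_eq (runs_zero _ _) _; first by rewrite /upd; do ?case: eqP => ?; lia.
    by regs; first [rewrite hz; lia|rewrite h0; lia].
  - by rewrite layout_not_right // /upd eqxx; lia.
apply: runs_eq (runs_zero _ _) _; first by rewrite /upd eqxx; lia.
by regs; rewrite hz.
Qed.

Lemma runs_commit L A p : (forall i, (A 2 i != None) = (i < L)) -> p 1 = 0 -> p 2 = 0 ->
  runs L commit (layout L A p)
    (layout L (set_array A 1 L predT (fun i => A 2 i == Some true)) p).
Proof.
move=> hA p1 p2; set V := fun i => _.
pose f i := layout L (set_array A 1 i predT V) (upd (upd p 1 i.+1) 2 i.+1).
have hf i : f i 2 = (array_cells (A 2), i.+1) by [].
apply: runs_seq; first exact: runs_inc.
apply: runs_seq; first exact: runs_inc.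
apply: (@runs_seq _ _ _ _ (f L)).
  have -> : layout L A (upd (upd p 1 (p 1).+1) 2 (upd p 1 (p 1).+1 2).+1) = f 0.
    rewrite /f (_ : set_array A 1 0 predT V = A) ?p1 /upd /= ?p2 //.
    apply: functional_extensionality => c; apply: functional_extensionality => i.
    by rewrite /set_array andbF.
  apply: runs_while => // [i hi|i hi|].
  - by rewrite hf /ascan /not_blank /=; move: (hA i); rewrite hi; case: (A 2 i).
  - apply: (@runs_seq _ _ _ _ (layout L (set_array A 1 i.+1 predT V)
             (upd (upd p 1 i.+1) 2 i.+1))).
      have -> : set_array A 1 i.+1 predT V = fun c k =>
          if (c == 1) && (k == i) then Some (V i) else set_array A 1 i predT V c k.
        apply: functional_extensionality => c; apply: functional_extensionality => k.
        rewrite /set_array ltnS !andbT; case: (c == 1) => //=.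
        by case: (ltngtP k i) => [||->].
      apply: runs_if; rewrite (@layout_is_one _ _ _ _ i) //.
      rewrite (_ : set_array A 1 i predT V 2 i = A 2 i) // -/(V i).
      by case: (V i); apply: runs_write_bit.
    apply: runs_seq; first exact: runs_inc.
    by apply: runs_eq (runs_inc _ _ _ _) _; rewrite /f; regs.
  - by rewrite hf /ascan /not_blank /=; move: (hA L); rewrite ltnn; case: (A 2 L).
apply: runs_seq; first by apply: runs_zero.
apply: runs_eq (runs_zero _ _) _ => //.
by regs; rewrite ?p1 ?p2.
Qed.

Lemma runs_setup w : 0 < size w ->
  runs (size w) setup (initial_store w)
    (layout (size w) (fun c i => if c == 0 then onth w i else None) (fun=> 0)).
Proof.
set L := size w => hL; set A := fun c i => _.
pose raw p : store := fun j =>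
  (if j < 4 then array_cells (A j) else fun i => if i == 0 then left_end else None,
   p j : nat).
pose pos i j := if j == 0 then i.+1 else if 3 < j then i else 0.
have raw_act g p : (forall j, g j <> MoveL) ->
    runs L (move_heads g) (raw p)
      (raw (fun j => if g j is MoveR then (p j).+1 else p j)).
  move=> hg; apply: runs_eq (runs_act _ _ _) _.
  by apply: functional_extensionality => j; rewrite /perform /raw /=; case: (g j) (hg j).
apply: runs_seq; first exact: runs_act.
apply: (@runs_seq _ _ _ _ (raw (fun=> 0))).
  apply: runs_eq (runs_act _ _ _) _; apply: functional_extensionality => j.
  rewrite /perform /raw /initial_store /=; congr pair.
  apply: functional_extensionality => -[|i] /=; first by case: ifP.
  by rewrite /A; case: j => [|[|[|[|j]]]].
apply: (@runs_seq _ _ _ _ (raw (pos 0))).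
  apply: runs_eq (raw_act _ _ _) _ => [j|]; first by case: eqP.
  congr raw; apply: functional_extensionality => j.
  by rewrite /pos; case: eqP => // _; case: ifP.
apply: (@runs_seq _ _ _ _ (raw (pos L))).
  have hs i : ascan (raw (pos i) 0) = omap inl (onth w i) by [].
  apply: (runs_while (f := fun i => raw (pos i))) => // [i hi|i hi|].
  - by rewrite hs; move: hi; rewrite -onthTE; case: (onth w i).
  - apply: runs_eq (raw_act _ _ _) _ => [j|]; first by case: ifP.
    congr raw; apply: functional_extensionality => j.
    by rewrite /pos; case: eqP => //= _; case: ifP.
  - by rewrite hs onth_default.
apply: (@runs_seq _ _ _ _ (layout L A (pos L))).
  apply: runs_eq (runs_act _ _ _) _; apply: functional_extensionality => j.
  rewrite /perform /raw /layout /pos /=; case: (ltnP 3 j) => hj; last first.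
    by rewrite ltnS hj; case: (j == 0).
  have -> : (j == 0) = false by case: j hj.
  rewrite ltnNge hj /=; congr pair; apply: functional_extensionality => i.
  by rewrite /register_cells; case: (i =P 0) => [->|_] //; case: (0 =P L) => // ?; lia.
apply: runs_seq; first by apply: runs_dec.
pose f i := layout L A (fun j => if (j == 0) || (3 < j) then L - i else 0).
have -> : layout L A (upd (pos L) 0 (pos L 0).-1) = f 0.
  congr layout; apply: functional_extensionality => j.
  by rewrite /upd /pos subn0; case: eqP => //= _.
apply: runs_eq (runs_while (f := f) (m := L) _ _ _ _) _ => // [i hi|i hi||].
- by rewrite layout_not_left subn_gt0.
- apply: runs_eq (runs_move_heads _ _ _) _ => [j|].
    by case: ifP => // _ _; lia.
  by congr layout; apply: functional_extensionality => j; case: ifP; lia.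
- by rewrite layout_not_left subnn.
- by congr layout; apply: functional_extensionality => j; rewrite subnn; case: ifP.
Qed.

Definition reading (w : seq bool) (m : nat -> bool) : bool -> nat -> bool :=
  fun b i => if b then m i else nth false w i.

Fixpoint memory (w : seq bool) (phi : expr) (t : nat) : nat -> bool :=
  if t is t'.+1 then
    fun x => (x < size w) &&
      truth (size w) (reading w (memory w phi t')) [:: x; t'] phi
  else fun=> false.

Lemma runs_program w phi g psi H : 0 < size w -> H <= size w ->
  (forall k m, k < size w -> truth (size w) (reading w m) [:: k] g = (k < H)) ->
  exists2 y, runs (size w) (program phi g psi) (initial_store w) y &
    forall i, (y 3).1 ((y 3).2 + i) =
      if i < H then Some (inl (truth (size w)
                       (reading w (memory w phi (size w))) [:: i] psi)) else None.
Proof.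
set L := size w => hL hH hg.
(* Contents of the arrays after [t] rounds: the memory and its buffer are blank at first and equal
   after each commit. *)
pose A t c i := match c with
  | 0 => onth w i
  | 1 | 2 => if (0 < t) && (i < L) then Some (memory w phi t i) else None
  | _ => None
  end.
pose q i j := if j == 4 then i else 0.
have bitsA t : bits (A t) = reading w (memory w phi t).
  apply: functional_extensionality => -[]; apply: functional_extensionality => i.
    rewrite /bits /=; case: t => [|t] //=; rewrite -/L; case: (i < L) => //=.
  rewrite /bits /=; rewrite -(odflt_onth false); by case: (onth w i) => [[]|].
have ok0 : stack_ok L [::] 4 (fun=> 0) by [].
have q0 : (fun=> 0) = q 0.
  by apply: functional_extensionality => j; rewrite /q; case: eqP.
set m := memory w phi L.
exists (layout L (set_array (A L) 3 L (fun k => k < H)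
                  (fun k => truth L (reading w m) [:: k] psi)) (upd (fun=> 0) 3 1));
  last first.
  move=> i; rewrite /layout /= /set_array /=.
  by case: (ltnP i H) => h; rewrite ?andbF // (leq_trans h hH).
apply: runs_seq; first exact: runs_setup.
rewrite -/L (_ : (fun c i => _) = A 0); last first.
  by apply: functional_extensionality => -[|[|[|c]]]; apply: functional_extensionality.
apply: (@runs_seq _ _ _ _ (layout L (A L) (q L))).
  rewrite q0; apply: (runs_while (f := fun i => layout L (A i) (q i))) => // [i hi|i hi|].
  - by rewrite layout_not_right // /q /= neq_ltn hi.
  - have ok : stack_ok L [:: 4] 5 (q i).
      have -> : q i = upd (fun=> 0) 4 i by [].
      by apply: stack_ok_bind => //; apply: stack_ok_push => //; apply: ltnW.
    apply: runs_seq; first by apply: (runs_fill _ _ _ hL _ ok).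
    apply: (@runs_seq _ _ _ _ (layout L (A i.+1) (q i))); last first.
      by apply: runs_eq (runs_inc _ _ _ _) _; rewrite /q; regs.
    rewrite bitsA; apply: runs_eq (runs_commit _ _ _) _ => //.
      move=> k; rewrite /set_array /= /truth /= andbT.
      by case: (k < L) => //; rewrite andbF.
    congr layout; apply: functional_extensionality => -[|[|[|c]]] //;
      apply: functional_extensionality => k;
      rewrite /set_array /truth /= ?andbT -?/L; case: (k < L); rewrite ?andbF //=.
    by congr Some; rewrite /truth /q /=; case: (0 < eval _ _ _ _).
  - by rewrite layout_not_right // /q /= eqxx.
apply: (@runs_seq _ _ _ _ (layout L (A L) (fun=> 0))).
  by apply: runs_eq (runs_zero _ _) _; rewrite ?q0 /q //; regs.
apply: (@runs_seq _ _ _ _ (layout L (set_array (A L) 3 L (fun k => k < H)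
                  (fun k => truth L (reading w m) [:: k] psi)) (fun=> 0))).
  apply: runs_eq (runs_fill _ _ _ hL _ ok0) _ => //.
  congr layout; apply: functional_extensionality => c.
  apply: functional_extensionality => k; rewrite /set_array bitsA.
  by case: (c == 3) => //; case: (ltnP k L) => //= hk; rewrite hg.
exact: runs_inc.
Qed.

Lemma poly_time_program phi g psi : exists (M : machine) (c d : nat),
  forall w H, 0 < size w -> H <= size w ->
  (forall k m, k < size w -> truth (size w) (reading w m) [:: k] g = (k < H)) ->
  computes_within M w (c * size w ^ d + c)
    (mkseq (fun k => truth (size w) (reading w (memory w phi (size w))) [:: k] psi) H).
Proof.
(* The constant comes from [L.+2 <= 3 * L] for [0 < L]. *)
set s := program phi g psi; exists (compile s), (3 ^ degree s), (degree s).
move=> w H hw hH hg; have [y hr hy] := runs_program phi psi hw hH hg.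
have [t [ht h1 h2]] := computes_within_compile hr hy; exists t; split=> //.
apply: leq_trans ht _; apply: leq_trans (leq_addr _ _); rewrite -expnMn.
by case: (degree s) => [|k]; rewrite ?expn0 ?leq_exp2r //; lia.
Qed.

(** * Leaf folding *)

Section Folding.

Variables (V : finType) (P Q : rel V).
Hypothesis P_sym : symmetric P.

(* [P i j] forbids keeping both [i] and [j], and [Q i j] forbids keeping [i]
   without [j]. *)
Definition feasible (X : {set V}) : Prop :=
  (forall i j, i \in X -> j \in X -> ~~ P i j) /\
  (forall i j, i \in X -> j \notin X -> ~~ Q i j).

Definition conflict : rel V :=
  fun i j => (i != j) && [|| P i j, Q i j | Q j i].

Definition compatible (a b : bool) (i j : V) : bool :=
  match a, b with
  | true, true => ~~ P i j
  | true, false => ~~ Q i j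
  | false, true => ~~ Q j i
  | false, false => true
  end.

(* A vertex [v] that has not been folded yet stands for the set of vertices
   folded into it. [D true v] and [D false v :\ v] are the best sets of kept
   vertices for this set, when [v] is kept and when it is not; [v \in D false v]
   records that [v] has not been folded, and [v \notin D true v] that [v] cannot
   be kept. *)
Definition table := bool -> V -> {set V}.
Implicit Types (D : table) (x : {set V}) (y : V -> bool).

Definition live D v := v \in D false v.
Definition part D (b : bool) v := if b then D true v else D false v :\ v.
Definition possible D (b : bool) v := b ==> (v \in D true v).

Definition choice D (b : bool) l p : bool :=
  [&& possible D true l, compatible true b l p &
      ~~ compatible false b l p || (#|part D false l| <= #|part D true l|)].

Definition foldable D (b : bool) l p : bool :=
  compatible false b l p || possible D true l && compatible true b l p.

(** Emptying the entries of [l] makes it cease to be live. Foldability can fail only for [b = true],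
    and the empty set then records that [p] can no longer be kept. *)
Definition fold l p D : table := fun b v =>
  if v == l then set0
  else if v == p then
    if foldable D b l p then D b p :|: part D (choice D b l p) l else set0
  else D b v.

Definition initial_table : table := fun b v =>
  if b && P v v then set0 else [set v].

Definition union_parts D y : {set V} :=
  [set k | [exists v, live D v && (k \in part D (y v) v)]].

(** The last two fields bound a feasible [x] using only its trace on the live vertices: replacing
    each merged part by the stored set for the same status of [v] loses nothing in total. *)
Record table_ok D : Prop := TableOk {
  table_disjoint : forall u v a b k, live D u -> live D v ->
    k \in D a u -> k \in D b v -> u = v;
  table_sound : forall y, (forall v, live D v -> possible D (y v) v) ->
    (forall i j, live D i -> live D j -> i != j -> compatible (y i) (y j) i j) ->
    feasible (union_parts D y);
  table_possible : forall x v, feasible x -> live D v -> possible D (v \in x) v;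
  table_optimal : forall x, feasible x ->
    #|x| <= \sum_(v | live D v) #|part D (v \in x) v| }.

Lemma compatible_sym a b i j : compatible a b i j = compatible b a j i.
Proof. by case: a b => -[] //=; rewrite P_sym. Qed.

Lemma compatible_feasible x i j :
  feasible x -> compatible (i \in x) (j \in x) i j.
Proof.
move=> [h1 h2]; case hi: (i \in x); case hj: (j \in x) => //=.
- exact: h1.
- by apply: h2; rewrite ?hj.
- by apply: h2; rewrite ?hi.
Qed.

Lemma compatible_conflict a b i j :
  i != j -> ~~ conflict i j -> compatible a b i j.
Proof.
rewrite /conflict => -> /=; rewrite !negb_or => /and3P[h1 h2 h3].
by case: a b => -[].
Qed.

Lemma part_sub D b v : part D b v \subset D b v.
Proof. by case: b => //=; apply: subD1set. Qed.

Lemma initial_table_ok : table_ok initial_table.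
Proof.
have in_initial b v k : (k \in initial_table b v) = (k == v) && ~~ (b && P v v).
  by rewrite /initial_table; case: (b && _); rewrite ?inE ?andbT ?andbF.
have hlive v : live initial_table v by rewrite /live in_initial eqxx.
have in_part b v k : (k \in part initial_table b v) = [&& b, k == v & ~~ P v v].
  case: b; first exact: (in_initial true).
  by rewrite /part in_setD1 (in_initial false) andbT andNb.
have hpart b v : possible initial_table b v = b ==> ~~ P v v.
  by rewrite /possible in_initial eqxx.
split=> [u v a b k _ _|y hy hc|x v [hP _] _|x [hP _]].
- by rewrite !in_initial => /andP[/eqP <- _] /andP[/eqP <- _].
- have in_union k : (k \in union_parts initial_table y) = y k.
    rewrite inE; apply/existsP/idP => [[v]|hk].
      by rewrite hlive in_part => /and4P[_ hv /eqP -> _].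
    exists k; rewrite hlive in_part hk eqxx /=.
    by have := hy k (hlive k); rewrite hpart hk.
  split=> i j; rewrite !in_union => hi hj.
    have [->|hij] := eqVneq i j.
      by have := hy j (hlive j); rewrite hpart hj.
    by have := hc i j (hlive i) (hlive j) hij; rewrite hi hj.
  have [e|hij] := eqVneq i j; first by rewrite -e hi in hj.
  by have := hc i j (hlive i) (hlive j) hij; rewrite hi (negPf hj).
- by rewrite hpart; apply/implyP => hv; apply: hP.
- rewrite -sum1_card big_mkcond /= [leqRHS](eq_bigl xpredT) => [|v]; last by rewrite hlive.
  apply: leq_sum => v _.
  case: ifP => // hv; rewrite (cardsD1 v) in_part eqxx /= hP //.
Qed.

Lemma mem_fold l p D b v k : k \in fold l p D b v =
  [&& v != l, (v != p) || foldable D b l p &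
      (k \in D b v) || (v == p) && (k \in part D (choice D b l p) l)].
Proof.
rewrite /fold; case: (v == l); first by rewrite inE.
case: (v =P p) => [->|_] /=; last by rewrite orbF.
by case: (foldable _ _ _ _); rewrite inE.
Qed.

Lemma choiceP D b l p : foldable D b l p ->
  possible D (choice D b l p) l && compatible (choice D b l p) b l p.
Proof.
have h0 : possible D false l by [].
rewrite /foldable /choice; move: (#|_| <= #|_|) => cmp.
case hp: (possible D true l); case ht: (compatible true b l p);
  case hf: (compatible false b l p); case: cmp => // _; by rewrite ?h0 ?hp ?ht ?hf.
Qed.

Lemma choice_optimal D a b l p : possible D a l -> compatible a b l p ->
  #|part D a l| <= #|part D (choice D b l p) l|.
Proof.
rewrite /choice; case: a => hp hc.
  rewrite hp hc; case: (compatible false b l p) => //; rewrite !andTb orFb.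
  by case: (leqP #|part D false l| #|part D true l|) => // /ltnW.
by case h: [&& _, _ & _] => //; move: h => /and3P[_ _]; rewrite hc.
Qed.

(** * Merging a leaf preserves the table invariant *)

Section Fold.

Variables (D : table) (l p : V).
Hypotheses (hD : table_ok D) (hl : live D l) (hp : live D p) (hlp : l != p).
Hypothesis leaf : forall u, live D u -> conflict l u -> u = p.

Let c b := choice D b l p.

Lemma live_fold v : live (fold l p D) v = (v != l) && live D v.
Proof.
rewrite /live mem_fold (_ : foldable D false l p) // orbT andTb.
case: (v =P p) => [->|_]; last by rewrite andFb orbF.
by rewrite -/(live D p) hp.
Qed.

Lemma notin_part a v u : live D u -> live D v -> u != v -> u \notin D a v.
Proof.
move=> hu hv huv; apply/negP => h.
by move: huv; rewrite (table_disjoint hD hu hv hu h) eqxx.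
Qed.

(** The mark [v] does not lie in the sets of [l], by disjointness, so deleting it commutes with the
    union. *)
Lemma part_fold b v : live D v -> v != l -> possible (fold l p D) b v ->
  part (fold l p D) b v = part D b v :|: (if v == p then part D (c b) l else set0).
Proof.
move=> hv hvl; have hn : v \notin part D (c b) l.
  apply: contra (notin_part (c b) hv hl hvl).
  exact: (subsetP (part_sub _ _ _)).
case: b hn => hn; rewrite /possible /part /=; last first.
  move=> _; apply/setP => k; rewrite !inE mem_fold hvl orbT /= -/(c _).
  case: (k =P v) => [->|_] //=; case: (v == p); rewrite ?inE ?orbF //.
  by rewrite (negPf hn).
rewrite mem_fold => /and3P[_ h _]; apply/setP => k; rewrite mem_fold hvl h !inE /=.
by case: (v == p); rewrite ?inE.
Qed.

Lemma possible_fold b v : live D v -> v != l ->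
  possible (fold l p D) b v =
  possible D b v && ((v != p) || foldable D b l p).
Proof.
move=> hv hvl; case: b => //=; last by rewrite orbT.
rewrite /possible /= mem_fold hvl /= andbC; congr andb.
case: (v =P p) => [e|_]; rewrite ?orbF //= -e.
suff /negPf -> : v \notin part D (choice D true l v) l by rewrite orbF.
apply: contra (notin_part (choice D true l v) hv hl hvl).
exact: (subsetP (part_sub _ _ _)).
Qed.

Lemma fold_ok : table_ok (fold l p D).
Proof.
have sub a v k : live D v -> v != l -> k \in fold l p D a v ->
    exists2 w, live D w && (w == v) || (w == l) && (v == p) & exists b, k \in D b w.
  move=> hv hvl; rewrite mem_fold => /and3P[_ _ /orP[h|/andP[e h]]].
    by exists v; [rewrite hv eqxx|exists a].
  exists l; first by rewrite eqxx e orbT.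
  by exists (choice D a l p); apply: (subsetP (part_sub _ _ _)) h.
split=> [u v a b k|y hy hc|x v hx|x hx].
- rewrite !live_fold => /andP[hul hu] /andP[hvl hv].
  move=> /(sub _ _ _ hu hul)[w hw [a' ha]] /(sub _ _ _ hv hvl)[z hz [b' hb]].
  have hlw : live D w by case/orP: hw => /andP[h h'] //; rewrite (eqP h).
  have hlz : live D z by case/orP: hz => /andP[h h'] //; rewrite (eqP h).
  have e := table_disjoint hD hlw hlz ha hb; rewrite -{z hlz hb}e in hz.
  case/orP: hw => /andP[h1 /eqP h2]; case/orP: hz => /andP[h3 /eqP h4].
  + by rewrite -h2.
  + by rewrite -h2 (eqP h3) eqxx in hul.
  + by rewrite -h4 (eqP h1) eqxx in hvl.
  + by rewrite h2 h4.
(* A selection on the merged table extends to the old one by giving [l] the status chosen for that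
   of [p]; the only live vertex that can conflict with [l] is [p]. *)
- pose y' v := if v == l then c (y p) else y v.
  have hpl : p != l by rewrite eq_sym.
  have hyl v : live D v -> v != l -> possible (fold l p D) (y v) v.
    by move=> hv hvl; apply: hy; rewrite live_fold hvl.
  have hfold : foldable D (y p) l p.
    by have := hyl p hp hpl; rewrite possible_fold // eqxx /= => /andP[].
  have /andP[hc1 hc2] := choiceP hfold.
  have hy'v v : v != l -> y' v = y v by rewrite /y' => /negPf ->.
  have hy'l : y' l = c (y p) by rewrite /y' eqxx.
  have hlu u : live D u -> u != l -> compatible (c (y p)) (y u) l u.
    move=> hu hul; case hcu: (conflict l u).
      by rewrite (leaf hu hcu).
    by apply: compatible_conflict; rewrite ?hcu // eq_sym.
  have -> : union_parts (fold l p D) y = union_parts D y'.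
    apply/setP => k; rewrite !inE; apply/existsP/existsP => -[v].
      rewrite live_fold => /andP[/andP[hvl hv]].
      rewrite part_fold ?hyl // inE => /orP[h|].
        by exists v; rewrite hv hy'v.
      case: (v =P p) => [->|_]; last by rewrite inE.
      by move=> h; exists l; rewrite hl hy'l.
    case/andP=> hv; case: (v =P l) => [->|/eqP hvl].
      rewrite hy'l => h; exists p; rewrite live_fold hpl hp /=.
      by rewrite part_fold ?hyl // inE eqxx h orbT.
    rewrite hy'v // => h; exists v; rewrite live_fold hvl hv /=.
    by rewrite part_fold ?hyl // inE h.
  apply: (table_sound hD) => [v hv|i j hi hj hij].
    case: (v =P l) => [->|/eqP hvl]; first by rewrite hy'l.
    by rewrite hy'v //; have := hyl v hv hvl; rewrite possible_fold // => /andP[].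
  case: (i =P l) hij => [->|/eqP hil] hij.
    by rewrite hy'l hy'v 1?eq_sym //; apply: hlu => //; rewrite eq_sym.
  case: (j =P l) hij => [->|/eqP hjl] hij.
    by rewrite hy'l hy'v // compatible_sym; apply: hlu.
  by rewrite !hy'v //; apply: hc; rewrite ?live_fold ?hil ?hjl.
- rewrite live_fold => /andP[hvl hv]; rewrite possible_fold // (table_possible hD) //=.
  case: (v =P p) => //= ->; rewrite /foldable.
  have := table_possible hD hx hl; have := compatible_feasible l p hx.
  by case: (l \in x) => -> // ->; rewrite orbT.
- have hposs v : live D v -> possible D (v \in x) v := table_possible hD hx.
  have hcomp := compatible_feasible l p hx.
  have hpl : p != l by rewrite eq_sym.
  have hposs' v : live D v -> v != l -> possible (fold l p D) (v \in x) v.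
    move=> hv hvl; rewrite possible_fold // hposs //=.
    case: (v =P p) => //= ->; rewrite /foldable.
    by have := hposs l hl; case: (l \in x) hcomp => -> // ->; rewrite orbT.
  apply: leq_trans (table_optimal hD hx) _.
  (* The terms of [l] and [p] are compared with the single new term of [p], whose two pieces are
     disjoint; all other terms agree. *)
  rewrite (bigD1 l) //= (bigD1 p) /= ?hp // [in leqRHS](bigD1 p) /=; last first.
    by rewrite live_fold hpl.
  rewrite addnA; apply: leq_add.
    rewrite part_fold ?hposs' // eqxx cardsU.
    have -> : part D (p \in x) p :&: part D (c (p \in x)) l = set0.
      apply/eqP; rewrite -subset0; apply/subsetP => k; rewrite inE => /andP[h1 h2].
      have := table_disjoint hD hp hl (subsetP (part_sub _ _ _) _ h1)
                (subsetP (part_sub _ _ _) _ h2).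
      by move/eqP; rewrite (negPf hpl).
    rewrite cards0 subn0 addnC leq_add2l.
    by apply: choice_optimal hcomp; apply: hposs.
  rewrite (eq_bigl (fun v => live (fold l p D) v && (v != p))); last first.
    by move=> v /=; rewrite live_fold [live D v && _]andbC.
  apply: leq_sum => v /andP[]; rewrite live_fold => /andP[hvl hv] hvp.
  by rewrite part_fold ?hposs' // (negPf hvp) setU0.
Qed.

End Fold.

Definition best D v : bool :=
  possible D true v && (#|part D false v| <= #|part D true v|).

Lemma best_optimal D : table_ok D ->
  (forall u v, live D u -> live D v -> ~~ conflict u v) ->
  feasible (union_parts D (best D)) /\
  forall x, feasible x -> #|x| <= #|union_parts D (best D)|.
Proof.
move=> hD hc; split.
  apply: (table_sound hD) => [v _|i j hi hj hij].
    by rewrite /best; case h: (possible D true v) => //=; case: (_ <= _).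
  by apply: compatible_conflict hij _; apply: hc.
move=> x hx; apply: leq_trans (table_optimal hD hx) _.
pose F v := if live D v then part D (best D v) v else set0.
have -> : union_parts D (best D) = \bigcup_v F v.
  apply/setP => k; rewrite inE; apply/existsP/bigcupP => -[v].
    by case/andP=> hv h; exists v; rewrite // /F hv.
  by rewrite /F; case: ifP => hv _; rewrite ?inE // => h; exists v; rewrite hv.
rewrite -sum1_card partition_disjoint_bigcup => [|i j hij]; last first.
  rewrite -setI_eq0 -subset0; apply/subsetP => k; rewrite !inE /F.
  case: ifP => hi; case: ifP => hj; rewrite ?inE ?andbF // => /andP[h1 h2].
  have := table_disjoint hD hi hj (subsetP (part_sub _ _ _) _ h1)
            (subsetP (part_sub _ _ _) _ h2).
  by move/eqP; rewrite (negPf hij).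
rewrite big_mkcond; apply: leq_sum => v _; rewrite sum1_card /F.
case: ifP => // hv; have := table_possible hD hx hv.
rewrite /best; case: (v \in x) => h.
  by rewrite h andTb; case: (leqP #|part D false v| #|part D true v|) => // /ltnW.
by case e: (_ && _) => //; case/andP: e.
Qed.

End Folding.

(** * Forests *)

Lemma acyclic_subrel (T : finType) (e e' : rel T) :
  subrel e e' -> acyclic e' -> acyclic e.
Proof.
move=> hs h [c [hc /andP[h1 h2]]]; apply: h; exists c; split=> //.
by rewrite /ucycle h2 (sub_cycle hs).
Qed.

(** Otherwise any simple path inside [A] extends at its head [x]: besides the next vertex, [x] has
    another neighbour [z] in [A], and [z] on the path would close a cycle. Paths would then outgrow
    [T]. *)
Lemma acyclic_leaf (T : finType) (e : rel T) (A : {set T}) u v :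
  symmetric e -> irreflexive e -> acyclic e ->
  u \in A -> v \in A -> e u v ->
  exists2 l, l \in A & #|[set w in A | e l w]| = 1.
Proof.
move=> hsym hirr hac hu hv huv.
have [/exists_inP[l hl /eqP h]|/exists_inPn hn] :=
  boolP [exists l in A, #|[set w in A | e l w]| == 1]; first by exists l.
suff h n : exists x p, [/\ size p = n.+1, path e x p, uniq (x :: p) & {subset x :: p <= A}].
  have [x [p [h1 _ h2 _]]] := h #|T|.
  by have := max_card (mem (x :: p)); rewrite (card_uniqP h2) /= h1 => /ltnW; rewrite ltnn.
elim: n => [|n [x [p [h1 h2 h3 h4]]]].
  exists u, [:: v]; split; rewrite /= ?huv ?inE ?andbT //.
    by apply/eqP => h; rewrite h hirr in huv.
  by move=> w; rewrite !inE => /orP[] /eqP->.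
case: p h1 h2 h3 h4 => // w p [h1] /= /andP[hxw hp] h3 h4.
have hx : x \in A by apply: h4; rewrite inE eqxx.
have hw : w \in A by apply: h4; rewrite !inE eqxx orbT.
have [z [hz hxz hzw]] : exists z, [/\ z \in A, e x z & z != w].
  have /(_ x hx) h := hn; have : [set z in A | e x z] != [set w].
    by apply: contra h => /eqP->; rewrite cards1.
  rewrite eqEsubset sub1set inE hw hxw !andbT => /subsetPn[z].
  by rewrite !inE => /andP[h5 h6] h7; exists z.
have hzx : z != x by apply/eqP => h; rewrite h hirr in hxz.
case hzp: (z \in p).
  case/splitPr: hzp hp h3 => p1 p2; rewrite cat_path /= => /and3P[hp1 hl _] h3.
  case: hac; exists (x :: w :: rcons p1 z); split; first by rewrite /= size_rcons.
  rewrite /ucycle /= hxw !rcons_path hp1 hl last_rcons hsym hxz /=.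
  have : uniq ((x :: w :: rcons p1 z) ++ p2) by rewrite /= cat_rcons.
  by rewrite cat_uniq => /andP[].
exists z, [:: x, w & p]; split.
- by rewrite /= -h1.
- by rewrite /= hxw hp hsym hxz.
- by rewrite cons_uniq !inE (negPf hzx) (negPf hzw) hzp.
- by move=> y; rewrite inE => /orP[/eqP->|] //; apply: h4.
Qed.

(** * Cluster deletion as a two-variable constraint problem *)

Lemma is_clusterP (T : finType) (e : rel T) : symmetric e ->
  is_cluster e <-> forall x y z, e x y -> e y z -> x != z -> e x z.
Proof.
move=> hsym; split=> [h x y z hxy hyz|h x y /connectP[p hp ->] {y}].
  by apply: h; apply: connect_trans (connect1 hxy) (connect1 hyz).
elim/last_ind: p hp => [|p y ih]; first by rewrite eqxx.
rewrite rcons_path last_rcons => /andP[/ih {}ih hy] hxy.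
by have [e0|hne] := eqVneq x (last x p); [rewrite [x in e x]e0|apply: h (ih hne) hy hxy].
Qed.

Section HedgeConstraints.

Variable H : hedge_graph.
Implicit Types (i j k : 'I_(nh H)) (x y z : 'I_(nv H)) (U : {set 'I_(nh H)}).

Definition joined k x y : bool := [set x; y] \in hedge k.

(** An induced path on three vertices. The case [i = j] is meaningful: it says that hedge [i] can
    never be kept. *)
Definition forbidden i j : bool :=
  [exists x, [exists y, [exists z,
    [&& x != z, joined i x y, joined j y z & ~~ [exists k, joined k x z]]]]].

(** Only two edges from the same hedge need be considered: if they come from distinct kept hedges,
    the absence of triangles puts the closing edge in one of those. *)
Definition requires i j : bool :=
  [exists x, [exists y, [exists z,
    [&& joined i x y, joined i y z & joined j x z]]]].

Lemma joinedC k x y : joined k x y = joined k y x.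
Proof. by rewrite /joined setUC. Qed.

Lemma edges_hedge e : (e \in edges H) = [exists k, e \in hedge k].
Proof.
have /and3P[/eqP <- _ _] := hedge_partition H.
apply/bigcupP/existsP => [[B /imsetP[k _ ->] h]|[k h]]; first by exists k.
by exists (hedge k) => //; apply: imset_f.
Qed.

Lemma hedge_eq i j e : e \in hedge i -> e \in hedge j -> i = j.
Proof.
move=> hi hj; apply: (@hedge_inj H).
have /and3P[_ /trivIsetP ht _] := hedge_partition H.
apply/eqP; apply: contraT => hij.
have hm k : hedge k \in [set hedge k' | k' : 'I_(nh H)] by apply: imset_f.
have := ht _ _ (hm i) (hm j) hij.
by rewrite -setI_eq0 => /eqP/setP/(_ e); rewrite !inE hi hj.
Qed.

Lemma joined_neq k x y : joined k x y -> x != y.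
Proof.
move=> h; have : [set x; y] \in edges H by rewrite edges_hedge; apply/existsP; exists k.
by move/edges_card2; rewrite cards2; case: (x != y).
Qed.

Lemma joined_intersection i j x y z :
  i != j -> joined i x y -> joined j y z -> hedge_intersection i j.
Proof.
move=> hij hi hj; rewrite /hedge_intersection hij /=.
apply/exists_inP; exists [set x; y] => //; apply/exists_inP; exists [set y; z] => //.
by apply/set0Pn; exists y; rewrite !inE eqxx orbT.
Qed.

Lemma hedge_intersection_sym : symmetric (@hedge_intersection H).
Proof.
move=> i j; rewrite /hedge_intersection eq_sym; congr andb.
by apply/exists_inP/exists_inP => -[e he /exists_inP[f hf h]];
  exists f => //; apply/exists_inP; exists e; rewrite // setIC.
Qed.

Lemma forbidden_sym : symmetric forbidden.
Proof.
have h i j : forbidden i j -> forbidden j i.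
  move=> /existsP[x /existsP[y /existsP[z /and4P[hxz hi hj hn]]]].
  apply/existsP; exists z; apply/existsP; exists y; apply/existsP; exists x.
  rewrite eq_sym hxz joinedC hj joinedC hi /=.
  by apply: contra hn => /existsP[k hk]; apply/existsP; exists k; rewrite joinedC.
by move=> i j; apply/idP/idP; apply: h.
Qed.

Lemma conflict_intersection i j :
  conflict forbidden requires i j -> hedge_intersection i j.
Proof.
move=> /andP[hij /or3P[]] /existsP[x /existsP[y /existsP[z]]].
- by move=> /and4P[_ h1 h2 _]; apply: joined_intersection h1 h2.
- by move=> /and3P[h1 _ h2]; apply: (@joined_intersection i j y x z); rewrite // joinedC.
- move=> /and3P[h1 _ h2]; rewrite hedge_intersection_sym.
  by apply: (@joined_intersection j i y x z); rewrite 1?eq_sym // joinedC.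
Qed.

Lemma remaining_adjE U x y :
  remaining_adj U x y = [exists k, (k \notin U) && joined k x y].
Proof.
rewrite /remaining_adj /remaining_edges inE edges_hedge.
apply/andP/existsP => [[hn /existsP[k hk]]|[k /andP[hk hj]]].
  exists k; rewrite /joined hk andbT; apply: contra hn => hU.
  by apply/bigcupP; exists k.
split; last by apply/existsP; exists k.
by apply/bigcupP => -[k' hk' h]; rewrite (hedge_eq hj h) hk' in hk.
Qed.

Lemma cluster_deletion_feasible U : acyclic (@hedge_intersection H) ->
  cluster_deletion U <-> feasible forbidden requires (~: U).
Proof.
move=> hac.
have hsym : symmetric (remaining_adj U).
  by move=> x y; rewrite !remaining_adjE; apply: eq_existsb => k; rewrite joinedC.
have remI k x y : k \notin U -> joined k x y -> remaining_adj U x y.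
  by move=> h1 h2; rewrite remaining_adjE; apply/existsP; exists k; rewrite h1.
have remE x y : remaining_adj U x y -> exists2 k, k \notin U & joined k x y.
  by rewrite remaining_adjE => /existsP[k /andP[h1 h2]]; exists k.
rewrite /cluster_deletion is_clusterP //; split=> [h|[hP hQ] x y z].
  split=> i j; rewrite !inE => hi; [|rewrite negbK] => hj; apply/negP =>
    /existsP[x /existsP[y /existsP[z]]].
    case/and4P=> hxz h1 h2 /negP; apply.
    have [k _ hk] := remE _ _ (h _ _ _ (remI _ _ _ hi h1) (remI _ _ _ hj h2) hxz).
    by apply/existsP; exists k.
  case/and3P=> h1 h2 h3.
  have [k hk hk'] := remE _ _ (h _ _ _ (remI _ _ _ hi h1) (remI _ _ _ hi h2) (joined_neq h3)).
  by rewrite (hedge_eq hk' h3) hj in hk.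
move=> /remE[i hi hxy] /remE[j hj hyz] hxz.
have := hP i j; rewrite !inE => /(_ hi hj); rewrite negb_exists => /forallP/(_ x).
rewrite negb_exists => /forallP/(_ y); rewrite negb_exists => /forallP/(_ z).
rewrite hxz hxy hyz /= negbK => /existsP[k hk].
(* If the hedge [k] of the closing edge were deleted, it would differ from [i] and [j]: then [i = j]
   violates a requirement, and [i != j] gives a triangle. *)
case hkU: (k \in U); last by apply: remI hk; rewrite hkU.
have hik : i != k by apply/eqP => e; rewrite e hkU in hi.
have hjk : j != k by apply/eqP => e; rewrite e hkU in hj.
have [e|hij] := eqVneq i j.
  have := hQ i k; rewrite !inE hkU => /(_ hi isT) /negP; case.
  apply/existsP; exists x; apply/existsP; exists y; apply/existsP; exists z.
  by rewrite hxy e hyz hk.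
(* Three pairwise intersecting hedges would form a triangle. *)
case: hac; exists [:: i; j; k]; split=> //.
rewrite /ucycle /= !inE negb_or hij hik hjk /= !andbT.
rewrite (joined_intersection hij hxy hyz) /=.
rewrite (@joined_intersection j k y z x) ?(joinedC k z) //=.
by rewrite (@joined_intersection k i z x y) 1?eq_sym // joinedC.
Qed.

Lemma nh_bound : 2 * nh H <= nv H * nv H.
Proof.
have hE : nh H <= #|edges H|.
  rewrite (card_partition (hedge_partition H)).
  rewrite big_imset /=; last by move=> i j _ _; apply: hedge_inj.
  rewrite -{1}(card_ord (nh H)) -sum1_card; apply: leq_sum => k _.
  have /and3P[_ _ h0] := hedge_partition H; rewrite card_gt0.
  by apply/eqP => e; rewrite -e imset_f in h0.
have h2 : #|edges H| <= 'C(nv H, 2).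
  have := card_draws 'I_(nv H) 2; rewrite card_ord => <-; apply: subset_leq_card.
  by apply/subsetP => e he; rewrite inE (edges_card2 he).
have := leq_trans hE h2; rewrite bin2 => h.
have : (nv H * (nv H).-1)./2.*2 <= nv H * nv H.
  by rewrite -[leqRHS]odd_double_half; nia.
by lia.
Qed.

End HedgeConstraints.

(** * The update as an expression *)

Definition Not e := Lt e One.
Definition And e f := Mul e f.
Definition Or e f := Add e f.
Definition Eq e f := Not (Or (Lt e f) (Lt f e)).
Definition Zero := Lt One One.
Definition Two := Add One One.

(** Decodes a unary prefix by counting the positions with no zero bit up to and including them;
    [NumH] does the same after the first separator. *)
Definition NumV := Count (Not (Count (And (Not (Lt (Var 1) (Var 0)))
                                          (Not (Rd false (Var 0)))))).
Definition NumH := Count (And (Lt NumV (Var 0))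
  (Not (Count (And (And (Lt NumV (Var 0)) (Not (Lt (Var 1) (Var 0))))
                   (Not (Rd false (Var 0))))))).

Definition CountV e := Count (And (Lt (Var 0) NumV) e).
Definition CountH e := Count (And (Lt (Var 0) NumH) e).

Definition Joined k x y :=
  Rd false (Add NumV (Add NumH (Add Two
    (Add (Mul (Var k) (Mul NumV NumV)) (Add (Mul (Var x) NumV) (Var y)))))).

(** Arguments of these formulas are de Bruijn indices, so each binder shifts them by one. Counting
    over a range serves both as a cardinality and, through its truth value, as an existential
    quantifier. *)
Definition Forbidden i j :=
  CountV (CountV (CountV (And (Not (Eq (Var 2) (Var 0)))
    (And (Joined i.+3 2 1) (And (Joined j.+3 1 0)
         (Not (CountH (Joined 0 3 1)))))))).

Definition Requires i j :=
  CountV (CountV (CountV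
    (And (Joined i.+3 2 1) (And (Joined i.+3 1 0) (Joined j.+3 2 0))))).

Definition Conflict i j :=
  And (Not (Eq (Var i) (Var j)))
      (Or (Forbidden i j) (Or (Requires i j) (Requires j i))).

Definition Compatible (a b : bool) i j :=
  match a, b with
  | true, true => Not (Forbidden i j)
  | true, false => Not (Requires i j)
  | false, true => Not (Requires j i)
  | false, false => One
  end.

(* Membership of [k] in [D b v] is stored at index [b h^2 + v h + k], where [h]
   is the number of hedges. *)
Definition Address (b : bool) v k :=
  Add (if b then Mul NumH NumH else Zero) (Add (Mul (Var v) NumH) (Var k)).
Definition InTable b v k := Rd true (Address b v k).
Definition InPart (b : bool) v k :=
  if b then InTable true v k
  else And (Not (Eq (Var k) (Var v))) (InTable false v k).
Definition CardPart b v := CountH (InPart b v.+1 0).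

Definition Choice b l p :=
  And (InTable true l l) (And (Compatible true b l p)
    (Or (Not (Compatible false b l p)) (Not (Lt (CardPart true l) (CardPart false l))))).
Definition Foldable b l p :=
  Or (Compatible false b l p) (And (InTable true l l) (Compatible true b l p)).
Definition InChosen c v k :=
  Or (And c (InPart true v k)) (And (Not c) (InPart false v k)).

Definition Leaf l :=
  And (InTable false l l)
      (Eq (CountH (And (InTable false 0 0) (Conflict l.+1 0))) One).
(** Fixes one leaf per round, the same for every cell of the table. *)
Definition FirstLeaf l :=
  And (Leaf l) (Not (CountH (And (Lt (Var 0) (Var l.+1)) (Leaf 0)))).

(** For a leaf [l] this singles out the vertex [p] into which it is merged, without naming it. *)
Definition Neighbour l v := And (InTable false v v) (Conflict l v).

Definition Folded b l v k :=
  And (Not (Eq (Var v) (Var l)))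
    (And (Or (Not (Neighbour l v)) (Foldable b l v))
         (Or (InTable b v k) (And (Neighbour l v) (InChosen (Choice b l v) l k)))).

Definition Next b v k :=
  Or (And (Not (CountH (Leaf 0))) (InTable b v k))
     (CountH (And (FirstLeaf 0) (Folded b 0 v.+1 k.+1))).

Definition Initial (b : bool) v k :=
  And (Eq (Var k) (Var v)) (if b then Not (Forbidden v v) else One).

Definition Cell b :=
  Or (And (Lt (Var 3) One) (Initial b 1 0))
     (And (Not (Lt (Var 3) One)) (Next b 1 0)).

(** Rather than decoding the index by division, the formula searches for the pair [v], [k] having it
    as address; injectivity of addresses makes the pair unique. *)
Definition UpdateAt b :=
  CountH (CountH (And (Eq (Var 2) (Address b 1 0)) (Cell b))).
Definition Update := Or (UpdateAt true) (UpdateAt false).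

Definition Best v :=
  And (InTable true v v) (Not (Lt (CardPart true v) (CardPart false v))).

Definition Deleted :=
  Not (CountH (And (InTable false 0 0) (InChosen (Best 0) 0 1))).

(** * Meaning of the expressions on an encoded hedge graph *)

Lemma count_iota_interval a b L :
  a <= b <= L -> count (fun i => a <= i < b) (iota 0 L) = b - a.
Proof.
move=> /andP[hab hbL].
have -> : L = a + ((b - a) + (L - b)) by lia.
rewrite iotaD iotaD !count_cat !add0n subnKC //.
rewrite (eq_in_count (a2 := pred0)) => [|i]; last by rewrite mem_iota /=; lia.
rewrite [X in _ + (X + _)](eq_in_count (a2 := predT)) => [|i]; last first.
  by rewrite mem_iota /=; lia.
rewrite [X in _ + (_ + X)](eq_in_count (a2 := pred0)) => [|i]; last first.
  by rewrite mem_iota /=; lia.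
by rewrite !count_pred0 count_predT size_iota add0n addn0.
Qed.

Lemma count_ord n L (f : pred nat) : n <= L ->
  count (fun i => (i < n) && f i) (iota 0 L) = #|[set i : 'I_n | f i]|.
Proof.
move=> h; rewrite -sum1_count -sum1_card.
rewrite (eq_bigl (fun i : 'I_n => f i)); last by move=> i; rewrite inE.
rewrite (big_ord_widen_cond _ f (fun=> 1) h) -[in LHS](subn0 L) big_mkord.
by apply: eq_bigl => i; rewrite andbC.
Qed.

Lemma nth_flatten_uniform (T S : Type) (x0 : S) (t0 : T) (f : T -> seq S) s m i j :
  (forall x, size (f x) = m) -> i < size s -> j < m ->
  nth x0 (flatten [seq f x | x <- s]) (i * m + j) = nth x0 (f (nth t0 s i)) j.
Proof.
move=> hf; elim: s i => [|x s ih] [|i] //= hi hj; rewrite nth_cat hf.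
  by rewrite mul0n add0n hj.
by rewrite ltnNge mulSn -addnA leq_addr /= addKn ih.
Qed.

Lemma size_flatten_uniform (T S : Type) (f : T -> seq S) s m :
  (forall x, size (f x) = m) -> size (flatten [seq f x | x <- s]) = size s * m.
Proof. by move=> hf; elim: s => //= x s ih; rewrite size_cat hf ih mulSn. Qed.

Section Semantics.

Variable H : hedge_graph.
Let n := nv H.
Let h := nh H.
Let w := encode_graph H.
Let L := size w.

Lemma size_adj_matrix (k : 'I_h) : size (adj_matrix k) = n * n.
Proof. by rewrite /adj_matrix size_allpairs !size_enum_ord. Qed.

Lemma size_encode_graph : L = n + h + 2 + h * (n * n).
Proof.
rewrite /L /w /encode_graph size_cat size_nseq /= size_cat size_nseq /=.
rewrite (size_flatten_uniform _ size_adj_matrix) size_enum_ord -/n -/h; lia.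
Qed.

Lemma nth_adj_matrix (k : 'I_h) (x y : 'I_n) :
  nth false (adj_matrix k) (x * n + y) = joined k x y.
Proof.
rewrite /adj_matrix (nth_flatten_uniform _ x (m := n)) ?size_enum_ord //; last first.
  by move=> i; rewrite size_map size_enum_ord.
by rewrite (nth_map y) ?size_enum_ord // !nth_ord_enum.
Qed.

Lemma address_lt (k a b : nat) (x y z : nat) :
  x < a -> y < b -> z < k -> x * (b * k) + (y * k + z) < a * (b * k).
Proof. by move=> hx hy hz; have := leq_mul hx (leqnn (b * k)); nia. Qed.

Lemma nth_encode_joined (k : 'I_h) (x y : 'I_n) :
  nth false w (n + (h + (2 + (k * (n * n) + (x * n + y))))) = joined k x y.
Proof.
rewrite /w /encode_graph nth_cat size_nseq -/n ltnNge leq_addr /= addKn.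
rewrite addnS /= nth_cat size_nseq -/h ltnNge leq_addr /= addKn /=.
rewrite (nth_flatten_uniform _ k size_adj_matrix) ?size_enum_ord //.
  by rewrite nth_ord_enum nth_adj_matrix.
by have := ltn_ord x; have := ltn_ord y; rewrite -/n; nia.
Qed.

Lemma nth_encode_prefix i : i <= (n + h).+1 ->
  nth false w i = (i != n) && (i != (n + h).+1).
Proof.
move=> hi; rewrite /w /encode_graph nth_cat size_nseq -/n.
case: ltnP => hin; first by rewrite nth_nseq hin; lia.
have [j ej] : exists j, i = n + j by exists (i - n); lia.
rewrite {i hin}ej addKn in hi *; case: j hi => [|j] hi /=; first by lia.
rewrite nth_cat size_nseq -/h; case: ltnP => hj; first by rewrite nth_nseq hj; lia.
have -> : j - h = 0 by lia.
by rewrite /=; lia.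
Qed.

Lemma size_encode_gt1 : 1 < L.
Proof. by rewrite size_encode_graph; lia. Qed.

Lemma size_encode_gt0 : 0 < L.
Proof. exact: ltnW size_encode_gt1. Qed.

Variable m : nat -> bool.
Let ev env e := eval L (reading w m) env e.
Let tr env e := truth L (reading w m) env e.

Lemma truth_Not env e : tr env (Not e) = ~~ tr env e.
Proof. by rewrite /tr /truth /=; case: (eval _ _ _ e). Qed.

Lemma truth_And env e f : tr env (And e f) = tr env e && tr env f.
Proof. by rewrite /tr /truth /=; have := size_encode_gt0; nia. Qed.

Lemma truth_Or env e f : tr env (Or e f) = tr env e || tr env f.
Proof. by rewrite /tr /truth /=; have := size_encode_gt0; lia. Qed.

Lemma truth_Lt env e f : tr env (Lt e f) = (ev env e < ev env f).
Proof. by rewrite /tr /truth lt0b. Qed.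

Lemma truth_Eq env e f : tr env (Eq e f) = (ev env e == ev env f).
Proof. by rewrite truth_Not truth_Or !truth_Lt; lia. Qed.

Lemma truth_Rd env b e : tr env (Rd b e) = reading w m b (ev env e).
Proof. by rewrite /tr /truth lt0b. Qed.

Lemma eval_Count env e :
  ev env (Count e) = count (fun i => tr (i :: env) e) (iota 0 L).
Proof. by []. Qed.

Lemma truth_Count env e :
  tr env (Count e) = has (fun i => tr (i :: env) e) (iota 0 L).
Proof. by rewrite has_count. Qed.

Lemma eval_Var env k : ev env (Var k) = nth 0 env k.
Proof. by []. Qed.

Lemma eval_Add env e f : ev env (Add e f) = minn (ev env e + ev env f) L.
Proof. by []. Qed.

Lemma eval_Mul env e f : ev env (Mul e f) = minn (ev env e * ev env f) L.
Proof. by []. Qed.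

Lemma eval_Two env : ev env Two = 2.
Proof. by rewrite /ev /=; have := size_encode_gt1; lia. Qed.

Lemma eval_NumV env : ev env NumV = n.
Proof.
rewrite eval_Count (eq_in_count (a2 := fun i => 0 <= i < n)).
  by rewrite count_iota_interval ?subn0 // size_encode_graph; lia.
move=> p; rewrite mem_iota /= add0n => hp; rewrite truth_Not truth_Count.
apply/hasPn/idP => [hall|hpn q].
  rewrite ltnNge; apply/negP => hnp.
  have := hall n; rewrite mem_iota truth_And !truth_Not truth_Lt truth_Rd !eval_Var /=.
  rewrite nth_encode_prefix; last by lia.
  by rewrite eqxx /= add0n (leq_ltn_trans hnp hp) -leqNgt hnp => /(_ isT).
rewrite mem_iota /= add0n => hq.
rewrite truth_And !truth_Not truth_Lt truth_Rd !eval_Var /= -leqNgt.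
apply/negP => /andP[hqp]; rewrite nth_encode_prefix; last by lia.
by lia.
Qed.

Lemma eval_NumH env : ev env NumH = h.
Proof.
rewrite eval_Count (eq_in_count (a2 := fun i => n.+1 <= i < (n + h).+1)).
  by rewrite count_iota_interval ?size_encode_graph; lia.
move=> p; rewrite mem_iota /= add0n => hp.
rewrite truth_And truth_Lt eval_NumV eval_Var truth_Not truth_Count /=.
case: ltnP => //= hnp; apply/hasPn/idP => [hall|hpn q].
  rewrite ltnNge; apply/negP => hnhp.
  have := hall (n + h).+1; rewrite mem_iota !truth_And !truth_Not !truth_Lt truth_Rd !eval_Var /=.
  rewrite eval_NumV nth_encode_prefix // eqxx andbF add0n (leq_ltn_trans hnhp hp).
  by rewrite -leqNgt hnhp ltnS leq_addr => /(_ isT).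
rewrite mem_iota /= add0n => hq.
rewrite !truth_And !truth_Not !truth_Lt truth_Rd eval_NumV !eval_Var /= -leqNgt.
apply/negP => /andP[/andP[hnq hqp]]; rewrite nth_encode_prefix; last by lia.
by lia.
Qed.

Lemma eval_CountV env e : ev env (CountV e) = #|[set x : 'I_n | tr ((x : nat) :: env) e]|.
Proof.
rewrite eval_Count -(count_ord (L := L) (fun i => tr (i :: env) e)); last first.
  by rewrite size_encode_graph; lia.
by apply: eq_count => i; rewrite truth_And truth_Lt eval_NumV.
Qed.

Lemma eval_CountH env e : ev env (CountH e) = #|[set x : 'I_h | tr ((x : nat) :: env) e]|.
Proof.
rewrite eval_Count -(count_ord (L := L) (fun i => tr (i :: env) e)); last first.
  by rewrite size_encode_graph; lia.
by apply: eq_count => i; rewrite truth_And truth_Lt eval_NumH.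
Qed.

Lemma truth_CountV env e : tr env (CountV e) = [exists x : 'I_n, tr ((x : nat) :: env) e].
Proof.
rewrite /tr /truth -/(ev _ _) eval_CountV card_gt0; apply/set0Pn/existsP => -[x hx];
  by exists x; move: hx; rewrite inE.
Qed.

Lemma truth_CountH env e : tr env (CountH e) = [exists x : 'I_h, tr ((x : nat) :: env) e].
Proof.
rewrite /tr /truth -/(ev _ _) eval_CountH card_gt0; apply/set0Pn/existsP => -[x hx];
  by exists x; move: hx; rewrite inE.
Qed.

Lemma truth_Joined env a b c (k : 'I_h) (x y : 'I_n) :
  nth 0 env a = k -> nth 0 env b = x -> nth 0 env c = y ->
  tr env (Joined a b c) = joined k x y.
Proof.
move=> ha hb hc; rewrite truth_Rd -nth_encode_joined /reading; congr (nth _ _ _).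
have hk := ltn_ord k; have hx := ltn_ord x; have hy := ltn_ord y.
have hlt : k * (n * n) + (x * n + y) < h * (n * n) by apply: address_lt.
(* The existence of [k] gives [0 < h], so even the intermediate product [n * n] stays below
   saturation. *)
have hnn : n * n <= h * (n * n) by rewrite leq_pmull; lia.
have hL := size_encode_graph.
rewrite !(eval_Add, eval_Mul, eval_NumV, eval_NumH, eval_Two, eval_Var) ha hb hc.
rewrite [minn (n * n) _](minn_idPl _); last by lia.
by rewrite !(minn_idPl _) //; lia.
Qed.
Lemma truth_Forbidden env a b (i j : 'I_h) :
  nth 0 env a = i -> nth 0 env b = j ->
  tr env (Forbidden a b) = forbidden i j.
Proof.
move=> ha hb; rewrite truth_CountV; apply: eq_existsb => x.
rewrite truth_CountV; apply: eq_existsb => y.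
rewrite truth_CountV; apply: eq_existsb => z.
rewrite !truth_And truth_Not truth_Eq !eval_Var truth_Not truth_CountH.
rewrite (truth_Joined (k := i) (x := x) (y := y)) //.
rewrite (truth_Joined (k := j) (x := y) (y := z)) //.
congr [&& _, _, _ & ~~ _]; apply: eq_existsb => k.
exact: (truth_Joined (k := k) (x := x) (y := z)).
Qed.

Lemma truth_Requires env a b (i j : 'I_h) :
  nth 0 env a = i -> nth 0 env b = j ->
  tr env (Requires a b) = requires i j.
Proof.
move=> ha hb; rewrite truth_CountV; apply: eq_existsb => x.
rewrite truth_CountV; apply: eq_existsb => y.
rewrite truth_CountV; apply: eq_existsb => z.
rewrite !truth_And (truth_Joined (k := i) (x := x) (y := y)) //.
rewrite (truth_Joined (k := i) (x := y) (y := z)) //.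
by rewrite (truth_Joined (k := j) (x := x) (y := z)).
Qed.

Lemma truth_Conflict env a b (i j : 'I_h) :
  nth 0 env a = i -> nth 0 env b = j ->
  tr env (Conflict a b) = conflict (@forbidden H) (@requires H) i j.
Proof.
move=> ha hb; rewrite truth_And truth_Not truth_Eq !eval_Var ha hb !truth_Or.
by rewrite (truth_Forbidden ha hb) (truth_Requires ha hb) (truth_Requires hb ha).
Qed.

Lemma truth_Compatible env c d a b (i j : 'I_h) :
  nth 0 env a = i -> nth 0 env b = j ->
  tr env (Compatible c d a b) = compatible (@forbidden H) (@requires H) c d i j.
Proof.
move=> ha hb; case: c d => -[] //=; rewrite truth_Not.
- by rewrite (truth_Forbidden ha hb).
- by rewrite (truth_Requires ha hb).
- by rewrite (truth_Requires hb ha).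
Qed.

Definition address (b : bool) (v k : nat) : nat :=
  (if b then h * h else 0) + (v * h + k).

Lemma address_lt_size b (v k : 'I_h) : address b v k < L.
Proof.
have hb := nh_bound H; rewrite -/n -/h in hb.
have hv := ltn_ord v; have hk := ltn_ord k.
have : h * (2 * h) <= h * (n * n) by rewrite leq_mul2l hb orbT.
have : v * h + k < h * h by nia.
by rewrite size_encode_graph /address; case: b; lia.
Qed.

Lemma address_inj b b' (v v' k k' : 'I_h) :
  address b v k = address b' v' k' -> [/\ b = b', v = v' & k = k'].
Proof.
rewrite /address => e.
have lt (u l : 'I_h) : u * h + l < h * h.
  by have := ltn_ord u; have := ltn_ord l; rewrite -/h; nia.
have h1 := lt v k; have h2 := lt v' k'.
have eb : b = b' by case: b b' e => -[] // e; lia.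
have {}e : v * h + k = v' * h + k' by move: e; rewrite eb; apply: addnI.
have h0 : 0 < h by apply: leq_ltn_trans (ltn_ord k).
split=> //; apply: val_inj => /=.
  by have := congr1 (fun i => i %/ h) e; rewrite !divnMDl // !divn_small // !addn0.
by have := congr1 (fun i => i %% h) e; rewrite !modnMDl !modn_small.
Qed.

Lemma eval_Address env b a c (v k : 'I_h) :
  nth 0 env a = v -> nth 0 env c = k -> ev env (Address b a c) = address b v k.
Proof.
move=> ha hc; have := address_lt_size b v k; rewrite /address => hlt.
have -> : ev env (Address b a c) =
    minn (minn (if b then h * h else 0) L + minn (minn (v * h) L + k) L) L.
  rewrite /Address !(eval_Add, eval_Mul, eval_Var) eval_NumH ha hc.
  by case: b {hlt}; rewrite ?eval_Mul ?eval_NumH ?min0n.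
by rewrite !(minn_idPl _); lia.
Qed.

Definition table_of (m' : nat -> bool) : table 'I_h :=
  fun b v => [set k : 'I_h | m' (address b v k)].
Let D := table_of m.

Lemma truth_InTable env b a c (v k : 'I_h) :
  nth 0 env a = v -> nth 0 env c = k -> tr env (InTable b a c) = (k \in D b v).
Proof.
by move=> ha hc; rewrite truth_Rd (eval_Address b ha hc) /reading inE.
Qed.

Lemma truth_InPart env b a c (v k : 'I_h) :
  nth 0 env a = v -> nth 0 env c = k -> tr env (InPart b a c) = (k \in part D b v).
Proof.
move=> ha hc; rewrite /part; case: b; first exact: truth_InTable.
by rewrite truth_And truth_Not truth_Eq !eval_Var ha hc (truth_InTable _ ha hc) in_setD1.
Qed.

Lemma eval_CardPart env b a (v : 'I_h) :
  nth 0 env a = v -> ev env (CardPart b a) = #|part D b v|.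
Proof.
move=> ha; rewrite eval_CountH; apply: eq_card => k; rewrite inE.
exact: truth_InPart.
Qed.

Let choiceD := choice (@forbidden H) (@requires H) D.

Lemma truth_Choice env b a c (l p : 'I_h) :
  nth 0 env a = l -> nth 0 env c = p -> tr env (Choice b a c) = choiceD b l p.
Proof.
move=> ha hc; rewrite !truth_And truth_Or !truth_Not truth_Lt.
rewrite !(truth_Compatible _ _ ha hc) !(eval_CardPart _ ha) (truth_InTable _ ha ha).
by rewrite -leqNgt.
Qed.

Lemma truth_Foldable env b a c (l p : 'I_h) :
  nth 0 env a = l -> nth 0 env c = p ->
  tr env (Foldable b a c) = foldable (@forbidden H) (@requires H) D b l p.
Proof.
move=> ha hc; rewrite truth_Or truth_And.
by rewrite !(truth_Compatible _ _ ha hc) (truth_InTable _ ha ha).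
Qed.

Lemma truth_InChosen env e a c (v k : 'I_h) :
  nth 0 env a = v -> nth 0 env c = k ->
  tr env (InChosen e a c) = (k \in part D (tr env e) v).
Proof.
move=> ha hc; rewrite truth_Or truth_And truth_And truth_Not !(truth_InPart _ ha hc).
by case: (tr env e); rewrite /= ?orbF.
Qed.

Let conf := conflict (@forbidden H) (@requires H).

Definition is_leaf (D' : table 'I_h) (l : 'I_h) : bool :=
  live D' l && (#|[set u | live D' u && conf l u]| == 1).

Definition is_first_leaf (D' : table 'I_h) (l : 'I_h) : bool :=
  is_leaf D' l && ~~ [exists u : 'I_h, (u < l) && is_leaf D' u].

Lemma truth_Leaf env a (l : 'I_h) : nth 0 env a = l -> tr env (Leaf a) = is_leaf D l.
Proof.
move=> ha; rewrite truth_And truth_Eq (truth_InTable _ ha ha) eval_CountH.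
congr (_ && (_ == _)); apply: eq_card => u; rewrite !inE truth_And.
by rewrite (truth_InTable _ (v := u) (k := u)) // (truth_Conflict (i := l) (j := u)).
Qed.

Lemma truth_FirstLeaf env a (l : 'I_h) :
  nth 0 env a = l -> tr env (FirstLeaf a) = is_first_leaf D l.
Proof.
move=> ha; rewrite truth_And truth_Not (truth_Leaf ha) truth_CountH.
congr (_ && ~~ _); apply: eq_existsb => u.
by rewrite truth_And truth_Lt !eval_Var /= ha (truth_Leaf (l := u)).
Qed.

Definition folded (D' : table 'I_h) b (l v k : 'I_h) : bool :=
  let nb := live D' v && conf l v in
  [&& v != l, ~~ nb || foldable (@forbidden H) (@requires H) D' b l v &
      (k \in D' b v) ||
      nb && (k \in part D' (choice (@forbidden H) (@requires H) D' b l v) l)].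

Definition next_table (D' : table 'I_h) : table 'I_h := fun b v =>
  [set k | ~~ [exists l, is_leaf D' l] && (k \in D' b v) ||
           [exists l, is_first_leaf D' l && folded D' b l v k]].

Lemma truth_Neighbour env a c (l v : 'I_h) :
  nth 0 env a = l -> nth 0 env c = v ->
  tr env (Neighbour a c) = live D v && conf l v.
Proof.
by move=> ha hc; rewrite truth_And (truth_InTable _ hc hc) (truth_Conflict ha hc).
Qed.

Lemma truth_Next env b a c (v k : 'I_h) :
  nth 0 env a = v -> nth 0 env c = k ->
  tr env (Next b a c) = (k \in next_table D b v).
Proof.
move=> ha hc; rewrite inE truth_Or truth_And truth_Not !truth_CountH.
rewrite (truth_InTable _ ha hc); congr (~~ _ && _ || _).
  by apply: eq_existsb => l; apply: truth_Leaf.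
apply: eq_existsb => l; rewrite truth_And (truth_FirstLeaf (l := l)) //; congr andb.
have hN := truth_Neighbour (env := (l : nat) :: env) (a := 0) (c := a.+1) (l := l) erefl ha.
rewrite truth_And truth_Not truth_Eq !eval_Var truth_And truth_Or truth_Not hN.
rewrite (truth_Foldable _ (l := l) (p := v)) // truth_Or truth_And hN.
rewrite (truth_InTable _ (v := v) (k := k)) //.
rewrite (truth_InChosen _ (v := l) (k := k)) // (truth_Choice _ (l := l) (p := v)) //.
by rewrite /= ha.
Qed.

Lemma truth_Initial env b a c (v k : 'I_h) :
  nth 0 env a = v -> nth 0 env c = k ->
  tr env (Initial b a c) = (k \in initial_table (@forbidden H) b v).
Proof.
move=> ha hc; rewrite truth_And truth_Eq !eval_Var ha hc /initial_table.
case: b; last by rewrite inE andbT.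
by rewrite truth_Not (truth_Forbidden ha ha); case: (forbidden v v); rewrite ?inE ?andbF ?andbT.
Qed.

Lemma truth_Cell b (v k : 'I_h) x t :
  tr [:: (k : nat); (v : nat); x; t] (Cell b) =
  (k \in (if t is 0 then initial_table (@forbidden H) else next_table D) b v).
Proof.
rewrite truth_Or truth_And (truth_Initial _ (v := v) (k := k)) // truth_And.
rewrite truth_Not !truth_Lt !eval_Var (truth_Next _ (v := v) (k := k)) //.
by case: t => [|t]; rewrite /= ?orbF.
Qed.

Lemma truth_UpdateAt b x t :
  tr [:: x; t] (UpdateAt b) = [exists v : 'I_h, [exists k : 'I_h, (x == address b v k) &&
    (k \in (if t is 0 then initial_table (@forbidden H) else next_table D) b v)]].
Proof.
rewrite truth_CountH; apply: eq_existsb => v.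
rewrite truth_CountH; apply: eq_existsb => k.
by rewrite truth_And truth_Eq eval_Var (eval_Address _ (v := v) (k := k)) // truth_Cell.
Qed.

Lemma truth_Update b (v k : 'I_h) t :
  tr [:: address b v k; t] Update =
  (k \in (if t is 0 then initial_table (@forbidden H) else next_table D) b v).
Proof.
rewrite truth_Or !truth_UpdateAt; move: (match t with 0 => _ | _ => _ end) => D'.
apply/orP/idP => [|hk].
  by case=> /existsP[v' /existsP[k' /andP[/eqP/address_inj[-> -> ->]]]].
have h' : [exists v' : 'I_h, [exists k' : 'I_h,
    (address b v k == address b v' k') && (k' \in D' b v')]].
  by apply/existsP; exists v; apply/existsP; exists k; rewrite eqxx.
by case: b h' {hk} => h'; [left|right].
Qed.

Lemma truth_Deleted (k : 'I_h) : tr [:: (k : nat)] Deleted =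
  (k \notin union_parts D (best D)).
Proof.
rewrite truth_Not inE truth_CountH; congr negb; apply: eq_existsb => v.
rewrite truth_And (truth_InTable _ (v := v) (k := v)) //.
rewrite (truth_InChosen _ (v := v) (k := k)) // truth_And truth_Not truth_Lt.
rewrite (truth_InTable _ (v := v) (k := v)) // !(eval_CardPart _ (v := v)) //.
by rewrite -leqNgt.
Qed.

End Semantics.
(** * Correctness *)

Section Correctness.

Variable H : hedge_graph.
Hypothesis hac : acyclic (@hedge_intersection H).
Let conf := conflict (@forbidden H) (@requires H).
Let w := encode_graph H.
Implicit Types D : table 'I_(nh H).

Lemma conflict_sym : symmetric conf.
Proof.
by move=> i j; rewrite /conf /conflict eq_sym forbidden_sym [requires i j || _]orbC.
Qed.

Lemma next_table_stable D : ~~ [exists l, is_leaf D l] -> next_table D = D.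
Proof.
move=> hn; apply: functional_extensionality => b.
apply: functional_extensionality => v; apply/setP => k; rewrite inE hn /=.
case: existsP => [[l /andP[/andP[hl _] _]]|_]; last by rewrite orbF.
by case/existsP: hn; exists l.
Qed.

Lemma next_table_fold D : [exists l, is_leaf D l] -> exists l p,
  [/\ live D l, live D p, l != p, (forall u, live D u -> conf l u -> u = p) &
      next_table D = fold (@forbidden H) (@requires H) l p D].
Proof.
move=> hex; have [l0 hl0] := existsP hex.
case: (arg_minnP (fun l : 'I_(nh H) => l : nat) hl0) => l hl hmin.
have hfirst l' : is_first_leaf D l' = (l' == l).
  apply/andP/eqP => [[h1 /existsPn h2]|->].
    apply/val_inj/anti_leq; rewrite hmin // andbT leqNgt.
    by have := h2 l; rewrite hl andbT.
  split=> //; apply/existsPn => u; apply/negP => /andP[hul hu].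
  by have := hmin u hu; rewrite leqNgt hul.
case/andP: (hl) => hlive /cards1P[p hp].
have hu u : (u == p) = live D u && conf l u.
  by have /setP/(_ u) := hp; rewrite !inE => ->.
have /andP[hlp hcp] : live D p && conf l p by rewrite -hu.
exists l, p; split=> // [|u h1 h2|]; first by case/andP: hcp.
  by apply/eqP; rewrite hu h1.
apply: functional_extensionality => b; apply: functional_extensionality => v.
apply/setP => k; rewrite inE hex mem_fold /=.
transitivity (folded D b l v k).
  apply/existsP/idP => [[l' /andP[]]|h]; first by rewrite hfirst => /eqP->.
  by exists l; rewrite hfirst eqxx.
by rewrite /folded -/conf -hu; case: (v =P p) => [->|].
Qed.

(** Round 0 only writes the initial table, so [t.+1] rounds amount to [t] attempted merges. *)
Lemma table_of_memory t : @table_of H (memory w Update t.+1) =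
  if t is 0 then initial_table (@forbidden H)
  else next_table (@table_of H (memory w Update t)).
Proof.
apply: functional_extensionality => b; apply: functional_extensionality => v.
apply/setP => k; rewrite inE /= address_lt_size truth_Update.
by case: t.
Qed.

(** Each merge removes one live vertex, which pays for its round; once leaves have run out the table
    is stable and the bound claims nothing. *)
Lemma iterated_table t :
  let D := @table_of H (memory w Update t.+1) in
  table_ok (@forbidden H) (@requires H) D /\
  ([exists l, is_leaf D l] -> #|[set v | live D v]| + t <= nh H).
Proof.
elim: t => [|t ih].
  rewrite table_of_memory; split; first exact: initial_table_ok.
  by move=> _; rewrite addn0 -[leqRHS]card_ord max_card.
rewrite table_of_memory; move: (@table_of H (memory w Update t.+1)) ih => D [hD hcard].
have [hex|hn] := boolP [exists l, is_leaf D l]; last first.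
  by rewrite next_table_stable //; split=> // h; rewrite h in hn.
have [l [p [hl hp hlp hleaf ->]]] := next_table_fold hex.
split; first exact: (fold_ok (@forbidden_sym H) hD hl hp hlp hleaf).
move=> _; apply: leq_trans (hcard hex); rewrite addnS ltn_add2r.
rewrite [in ltnRHS](cardsD1 l) inE hl add1n ltnS; apply: subset_leq_card.
by apply/subsetP => v; rewrite !inE live_fold.
Qed.

Lemma final_table :
  let D := @table_of H (memory w Update (size w)) in
  table_ok (@forbidden H) (@requires H) D /\
  (forall u v, live D u -> live D v -> ~~ conf u v).
Proof.
have [t ht] : exists t, size w = t.+1.
  by exists (size w).-1; rewrite prednK // size_encode_gt0.
(* The two separators of the encoding make [L] at least [h + 2], so a leaf surviving all rounds
   would contradict the count of live vertices. *)
have hth : nh H < t by have := size_encode_graph H; rewrite -/w ht; lia.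
rewrite ht; have := iterated_table t.
move: (@table_of H (memory w Update t.+1)) => D /= [hD hcard].
split=> // u v hu hv; apply/negP => huv.
have hacc : acyclic conf := acyclic_subrel (@conflict_intersection H) hac.
have hirr : irreflexive conf by move=> i; rewrite /conf /conflict eqxx.
have hlive x : live D x -> x \in [set x | live D x] by rewrite inE.
have [l] := acyclic_leaf conflict_sym hirr hacc (hlive u hu) (hlive v hv) huv.
rewrite inE => hl hl1; have hleaf : is_leaf D l.
  by rewrite /is_leaf hl -hl1; apply/eqP/eq_card => x; rewrite !inE.
have : #|[set x | live D x]| + t <= nh H by apply: hcard; apply/existsP; exists l.
lia.
Qed.

End Correctness.

Theorem theorem6p7 :
  poly_time_solvable
    (O := fun H : hedge_graph => {set 'I_(nh H)})
    encode_graph encode_hedges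
    (fun H : hedge_graph => acyclic (@hedge_intersection H))
    min_cluster_deletion.
Proof.
have [M [c [d hM]]] := poly_time_program Update (Lt (Var 0) NumH) Deleted.
exists M, c, d => H hac.
have [hD hconf] := final_table hac.
have [hX hopt] := best_optimal hD hconf.
set D := @table_of H (memory _ Update (size (encode_graph H))) in hD hconf hX hopt.
exists (~: union_parts D (best D)).
  split; first by apply/(cluster_deletion_feasible _ hac); rewrite setCK.
  move=> U' /(cluster_deletion_feasible _ hac)/hopt hU.
  (* A set and its complement have constant total size, so a maximum kept set leaves a minimum
     deleted set. *)
  rewrite -(leq_add2l #|union_parts D (best D)|) cardsC -(cardsC U').
  by rewrite [leqRHS]addnC leq_add2l.
have -> : encode_hedges (~: union_parts D (best D)) =
    mkseq (fun k => truth (size (encode_graph H))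
      (reading (encode_graph H)
         (memory (encode_graph H) Update (size (encode_graph H)))) [:: k] Deleted) (nh H).
  rewrite /encode_hedges /mkseq -val_enum_ord -map_comp; apply: eq_map => k.
  by rewrite /= truth_Deleted inE.
apply: hM => [||k m hk].
- exact: size_encode_gt0.
- by rewrite size_encode_graph; lia.
- by rewrite truth_Lt eval_NumH eval_Var.
Qed.
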